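(* Let $m\ge2$. Let $\Xi^{\boldsymbol{\alpha}'}=(\xi^{\mathbf{A}'},\zeta^{\mathbf{A}})$ be a constant pure tractor spinor on $\mathcal{Q}^{2m}$, and let $\mathcal{U}:=\mathcal{Q}^{2m}\setminus\check{\Xi}$ where $\check{\Xi}$ is the $\beta$-plane defined by $\Xi^{\boldsymbol{\alpha}'}$. Then $\xi^{\mathbf{A}'}$ is a pure conformal Killing spinor on $\mathcal{Q}^{2m}$, and its associated null structure $N_\xi$ on $\mathcal{U}$ arises from the submanifold in $\widehat{\mathcal{U}}\subset\mathbb{PT}$ defined by $$\Gamma^{(k)}_{\boldsymbol{\alpha}\boldsymbol{\beta}'}Z^{\boldsymbol{\alpha}}\Xi^{\boldsymbol{\beta}'}=0,\qquad\text{for } k<m,\quad k\equiv m\pmod 2 .$$ Each leaf of $N_\xi$ consists of an $\alpha$-plane intersecting $\check{\Xi}$ in an $(m-1)$-plane.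
   Context: Everything is holomorphic; $n=2m$. $\mathbb{V}\cong\mathbb{C}^{2m+2}$ is oriented with a non-degenerate symmetric bilinear form $h_{\mathcal{A}\mathcal{B}}$; $\mathbb{S}$ and $\mathbb{S}'$ are the two $2^m$-dimensional chiral spinor representations of $\mathrm{Spin}(2m+2,\mathbb{C})$ (unprimed and primed indices), and the Clifford generators $\Gamma_{\mathcal{A}}$ exchange $\mathbb{S}$ and $\mathbb{S}'$ and satisfy $\Gamma_{(\mathcal{A}}\Gamma_{\mathcal{B})}=-h_{\mathcal{A}\mathcal{B}}\,\mathrm{Id}$. $\Gamma^{(k)}_{\boldsymbol{\alpha}\boldsymbol{\beta}'}:\mathbb{S}\times\mathbb{S}'\to\wedge^k\mathbb{V}^*$, for $k\equiv m\pmod 2$, are the bilinear forms obtained by pairing, with the spin-invariant bilinear form on $\mathbb{S}\oplus\mathbb{S}'$, the skew-symmetrised product of $k$ Clifford generators applied to the first argument with the second argument. $\mathcal{Q}^{2m}=\{[X]\in\mathbb{P}\mathbb{V}:h(X,X)=0\}$ carries its natural holomorphic conformal structure. An $\alpha$-plane (respectively $\beta$-plane) is a self-dual (respectively anti-self-dual) $m$-dimensional linear subspace of $\mathcal{Q}^{2m}$. A non-zero chiral spinor $Z$ is pure if $\{V\in\mathbb{V}:V^{\mathcal{A}}\Gamma_{\mathcal{A}}Z=0\}$ has dimension $m+1$; its projectivisation $\check{Z}$ is an $\alpha$-plane if $Z\in\mathbb{S}$ and a $\beta$-plane if $Z\in\mathbb{S}'$. The twistor space $\mathbb{PT}$ is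 the space of $\alpha$-planes, identified with the projective pure spinors in $\mathbb{P}\mathbb{S}$. For $x\in\mathcal{Q}^{2m}$, $\hat{x}=\{Z\in\mathbb{PT}:x\in\check{Z}\}$ and $\widehat{\mathcal{U}}=\bigcup_{x\in\mathcal{U}}\hat{x}$. A constant tractor spinor $\Xi^{\boldsymbol{\alpha}'}$ is a parallel section of the primed tractor spinor bundle, i.e. an element of $\mathbb{S}'$; it is pure if that element is pure. Its component $\xi^{\mathbf{A}'}$ is its projection, at $x=[X]$, to the quotient of $\mathbb{S}'$ by $\ker(X^{\mathcal{A}}\Gamma_{\mathcal{A}})$. In the standard chart $\mathbb{C}\mathbb{E}^{2m}$ with flat metric, flat coordinates $x^a$ and Clifford generators $\gamma_a$ of $\mathbb{C}\mathbb{E}^{2m}$: $\xi=\mathring{\xi}-\frac1{\sqrt2}x^a\gamma_a\mathring{\zeta}$, $\zeta=\mathring{\zeta}$, where $\mathring\xi$ and $\mathring\zeta$ are constant chiral spinors of opposite chirality. A conformal Killing spinor is a spinor field $\xi$ with $\nabla_a\xi+\frac1{\sqrt2}\gamma_a\zeta=0$ for some $\zeta$ (conformally invariant). It is pure if, where non-zero, its annihilator $\{v\in\mathrm{T}_x\mathcal{Q}^{2m}:v^a\gamma_a\xi=0\}$ is $m$-dimensional; this annihilator is the totally null rank-$m$ distribution $N_\xi$. A null structure is an integrable totally null rank-$m$ distribution. ''$N_\xi$ arises from $\mathcal{W}\subset\widehat{\mathcal{U}}$'' means: for each $x\in\mathcal{U}$ the submanifold $\mathcal{W}$ meets $\hat{x}$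 in a point $Z_x$ and $(N_\xi)_x=\mathrm{T}_x\check{Z}_x$, so that the leaves of $N_\xi$ are the $\alpha$-planes $\check{Z}$, $Z\in\mathcal{W}$ (restricted to $\mathcal{U}$). *)

(* Defs.v *)
From HB Require Import structures.
From mathcomp Require Import all_boot all_order all_algebra all_fingroup.
From mathcomp Require Import all_classical all_reals all_analysis.
From Stdlib Require Relation_Operators.

Set Implicit Arguments.
Unset Strict Implicit.
Unset Printing Implicit Defensive.

Import Order.TTheory GRing.Theory Num.Theory.
Import numFieldNormedType.Exports.
Local Open Scope ring_scope.
Local Open Scope classical_set_scope.

(* Geometric conventions used throughout.
   - Points of a projective space P(E) are the 1-dimensional subspaces
     x : {vspace E}; [vpick x] is a non-zero vector spanning such an x.  Linear
     subspaces of P(E) of dimension d are the (d+1)-dimensional subspaces of E.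
   - The tangent space of Q at x is Hom(x, x^perp / x); its subspaces of
     dimension d are represented by the (d+1)-dimensional subspaces of V that
     lie between x and x^perp.  For a linear subspace A of Q through x, the
     subspace representing T_x A is A itself.
   - Differential conditions on subsets of, or maps to, a projective space are
     expressed through non-zero representatives.
   The field C is meant to be the complex numbers R[i], R : realType; keeping it
   abstract lets the normed module structures on matrices be inferred. *)

Notation vect C m := 'rV[C]_(m.+1 + m.+1).
Notation spinor C m := 'cV[C]_(2 ^ m).

Definition dirac_gen (C : numClosedFieldType) (m : nat)
    (G G' : 'M[C]_(2 ^ m)) : 'M[C]_(2 ^ m + 2 ^ m) :=
  block_mx 0 G' G 0.

(* The skew-symmetrised product M_[1 ... M_k]. *)
Definition skew_prod (C : fieldType) (n k : nat) (M : 'I_k -> 'M[C]_n) : 'M[C]_n :=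
  (k`!%:R)^-1 *: \sum_(s : 'S_k) ((-1) ^+ s *: \prod_(i < k) M (s i)).

(* V = C^(2m+2) with the form hmx; S = S' = C^(2^m) as vector spaces;
   gam a : S -> S' and gam' a : S' -> S are the two off-diagonal blocks of the
   a-th Clifford generator acting on S (+) S'.

   The orientation is given by the volume form (v_1, ..., v_(2m+2)) |->
   vol * det (v_1, ..., v_(2m+2)), which takes the values 1 and -1 on
   h-orthonormal frames.

   The axiom ss_chirality says that S and S' are the two eigenspaces of the
   volume element Gamma_[1 ... Gamma_(2m+2)], labelled relative to the
   orientation so that annihilators of pure spinors in S are self-dual in the
   sense of [self_dual] below.  For a pure Z in S annihilated by e_1, ..., e_p,
   p = m + 1, and null f_i with h (e_i, f_j) = delta_ij, the skew product of
   (e_1, ..., e_p, f_1, ..., f_p) maps Z to (-1)^(p(p+1)/2) Z, and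
   (-1)^(p(p+1)/2) / 'i^p = 'i^(odd p).

   ss_form is the Gram matrix of the spin-invariant bilinear form on S (+) S';
   Spin(V, h) is generated by the products of two unit vectors. *)
Record spin_space (C : numClosedFieldType) (m : nat) := SpinSpace {
  ss_h : 'M[C]_(m.+1 + m.+1);
  ss_vol : C;
  gam : 'I_(m.+1 + m.+1) -> 'M[C]_(2 ^ m);
  gam' : 'I_(m.+1 + m.+1) -> 'M[C]_(2 ^ m);
  ss_form : 'M[C]_(2 ^ m + 2 ^ m);
  ss_h_sym : ss_h^T = ss_h;
  ss_h_nondeg : ss_h \in unitmx;
  ss_vol_norm : ss_vol ^+ 2 = \det ss_h;
  ss_clifford : forall a b,
    2^-1 *: (dirac_gen (gam a) (gam' a) *m dirac_gen (gam b) (gam' b)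
             + dirac_gen (gam b) (gam' b) *m dirac_gen (gam a) (gam' a))
    = (- ss_h a b)%:M;
  ss_chirality :
    skew_prod (fun a => dirac_gen (gam a) (gam' a))
    = ('i ^+ odd m.+1 * ss_vol) *: block_mx 1%:M 0 0 (- 1%:M);
  ss_form_nondeg : ss_form \in unitmx;
  ss_form_inv : forall u v : vect C m,
    let cliff (w : vect C m) :=
      \sum_a (w 0 a *: dirac_gen (gam a) (gam' a)) in
    (u *m ss_h *m u^T) 0 0 = 1 -> (v *m ss_h *m v^T) 0 0 = 1 ->
    (cliff u *m cliff v)^T *m ss_form *m (cliff u *m cliff v) = ss_form
}.

Section Spinors.
Context {C : numClosedFieldType} {m : nat} (D : spin_space C m).
Local Notation V := (vect C m).
Local Notation S := (spinor C m).

Definition hform (u v : V) : C := (u *m ss_h D *m v^T) 0 0.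

(* v^A Gamma_A restricted to S (with values in S') and to S' (with values in S) *)
Definition cl (v : V) : 'M[C]_(2 ^ m) := \sum_a (v 0 a *: gam D a).
Definition cl' (v : V) : 'M[C]_(2 ^ m) := \sum_a (v 0 a *: gam' D a).

(* The k-form Gamma^(k)(Z, Xi), Z in S and Xi in S', evaluated on k vectors. *)
Definition Gamma (k : nat) (Z Xi : S) (v : 'I_k -> V) : C :=
  ((skew_prod (fun i => dirac_gen (cl (v i)) (cl' (v i))) *m col_mx Z 0)^T
     *m ss_form D *m col_mx 0 Xi) 0 0.

Definition ann (Z : S) : {vspace V} := lker (linfun (fun v : V => cl v *m Z)).
Definition ann' (Xi : S) : {vspace V} := lker (linfun (fun v : V => cl' v *m Xi)).

Definition pure (Z : S) : Prop := Z != 0 /\ \dim (ann Z) = m.+1.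
Definition pure' (Xi : S) : Prop := Xi != 0 /\ \dim (ann' Xi) = m.+1.

Definition perp (X : V) : {vspace V} :=
  lker (linfun (fun v : V => hform X v : C^o)).

Definition totally_null (A : {vspace V}) : Prop :=
  forall u v, u \in A -> v \in A -> hform u v = 0.

(* Q^(2m) as a set of points of P(V) *)
Definition quadric : set {vspace V} :=
  [set x | \dim x = 1%N /\ totally_null x].

(* For e = (e_1, ..., e_(m+1)) spanning A, the (m+1)-form
   alpha = h(e_1, -) /\ ... /\ h(e_(m+1), -) is
   v |-> det (h(e_i, v_j)), and its Hodge dual is v |-> vol (e, v).  As the
   square of the Hodge star on (m+1)-forms is (-1)^(m+1), self-dual means
   *alpha = 'i^(m+1) alpha. *)
Definition self_dual (A : {vspace V}) : Prop :=
  forall e v : 'M[C]_(m.+1, m.+1 + m.+1),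
    (forall i, row i e \in A) ->
    ss_vol D * \det (col_mx e v) = 'i ^+ m.+1 * \det (e *m ss_h D *m v^T).

Definition alpha_plane (A : {vspace V}) : Prop :=
  [/\ \dim A = m.+1, totally_null A & self_dual A].

(* Twistor space, as the set of points of P(S) given by pure spinors, and the
   linear subspace of Q defined by a twistor. *)
Definition PT : set {vspace S} := [set z | \dim z = 1%N /\ pure (vpick z)].
Definition check (z : {vspace S}) : {vspace V} := ann (vpick z).
Definition hat (x : {vspace V}) : set {vspace S} :=
  [set z | PT z /\ (x <= check z)%VS].
Definition hatU (U : set {vspace V}) : set {vspace S} :=
  \bigcup_(x in U) hat x.

(* A (primed) spinor field on Q is a section of the bundle whose fibre at x = [X]
   is S' / ker (X^A Gamma_A).  It is given here by a representative in S' at each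
   point; everything below depends only on the classes. *)
Definition spinor_field := {vspace V} -> S.

(* The projection of the constant section Xi of the tractor spinor bundle. *)
Definition component (Xi : S) : spinor_field := fun=> Xi.

Definition nonvanishing_at (xi : spinor_field) (x : {vspace V}) : Prop :=
  cl' (vpick x) *m xi x != 0.

(* The annihilator of xi in T_x Q: for v in X^perp, the tractor Clifford action
   of v descends to a map S' / ker X -> S / ker X, which is the Clifford action
   of the tangent vector [v]; v annihilates the class of xi when
   v^A Gamma_A xi lies in the kernel of X^A Gamma_A on S. *)
Definition annihilator (xi : spinor_field) (x : {vspace V}) : {vspace V} :=
  let X := vpick x in
  (perp X :&: lker (linfun (fun v : V => cl X *m (cl' v *m xi x))))%VS.

Definition pure_field (xi : spinor_field) : Prop :=
  forall x, quadric x -> nonvanishing_at xi x ->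
    \dim (annihilator xi x) = m.+1.

(* A standard chart of Q: Y is the point at infinity, O the origin, and the rows
   of e form a basis of the flat space E = <O, Y>^perp with metric
   g_ab = h(e_a, e_b). *)
Definition std_chart (O Y : V) (e : 'M[C]_(m + m, m.+1 + m.+1)) : Prop :=
  [/\ hform O O = 0, hform Y Y = 0, hform O Y = 1, row_free e
    & forall a, hform O (row a e) = 0 /\ hform Y (row a e) = 0].

Definition chart_point (O Y : V) (e : 'M[C]_(m + m, m.+1 + m.+1))
    (x : 'rV[C]_(m + m)) : V :=
  O + x *m e - (2^-1 * hform (x *m e) (x *m e)) *: Y.

(* The equation nabla_a xi + 1/sqrt 2 gamma_a zeta = 0, for the flat metric of
   every standard chart (these cover Q, and the equation is conformally
   invariant).  In the chart with point at infinity Y and X = chart_point x, the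
   kernels of X and Y are complementary, so that the spinor bundles S' / ker X
   and S / ker X are trivialised by ker Y; this is the flat trivialisation, with
   e_a^A Gamma_A acting on ker Y as gamma_a.  The functions f and zeta are
   the spinor fields in this trivialisation; f represents the same class as
   xi. *)
Definition conformal_killing (xi : spinor_field) : Prop :=
  forall (O Y : V) (e : 'M[C]_(m + m, m.+1 + m.+1)), std_chart O Y e ->
  exists f zeta : 'rV[C]_(m + m) -> S,
    forall x : 'rV[C]_(m + m), let X := chart_point O Y e x in
      [/\ cl' Y *m f x = 0, cl Y *m zeta x = 0,
          cl' X *m (f x - xi <[X]>%VS) = 0,
          differentiable f x
        & forall a, 'D_(delta_mx 0 a) f x + (sqrtC 2)^-1 *: (cl (row a e) *m zeta x) = 0].

Section Distribution.
(* a distribution N of rank m on a subset U of Q *)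
Variables (N : {vspace V} -> {vspace V}) (U : set {vspace V}).

(* Image of an m-dimensional parametrised integral manifold of N.  The vector
   phi p represents a point of Q, and <phi p> + im (d phi_p) represents the
   image of the tangent map. *)
Definition integral_patch (P : set {vspace V}) : Prop :=
  exists (r : C) (phi : 'rV[C]_m -> V), [/\ 0 < r,
    forall p, ball (0 : 'rV[C]_m) r p ->
      [/\ differentiable phi p, phi p != 0, U <[phi p]>%VS
        & (<[phi p]> + limg (linfun ('d phi p)))%VS = N <[phi p]>%VS]
    & P = [set <[phi p]>%VS | p in ball (0 : 'rV[C]_m) r]].

(* immersed integral manifolds: unions of patches *)
Definition integral_manifold (L : set {vspace V}) : Prop :=
  forall x, L x -> exists P, [/\ integral_patch P, P x & P `<=` L].

(* connectedness in the topology of the immersed manifold *)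
Definition int_connected (L : set {vspace V}) : Prop :=
  forall x y, L x -> L y ->
    Relation_Operators.clos_refl_trans _
      (fun x' y' => exists P, [/\ integral_patch P, P `<=` L, P x' & P y']) x y.

Definition leaf (L : set {vspace V}) : Prop :=
  [/\ L !=set0, integral_manifold L, int_connected L
    & forall L', integral_manifold L' -> int_connected L' ->
        L `<=` L' -> L' = L].

Definition holomorphic_distribution : Prop :=
  forall X0 : V, X0 != 0 -> U <[X0]>%VS ->
  exists s : 'I_m.+1 -> V -> V, \forall X \near X0,
    (forall i, differentiable (s i) X) /\
    (U <[X]>%VS -> N <[X]>%VS = (\sum_i <[s i X]>)%VS).

Definition integrable_distribution : Prop :=
  forall x, U x -> exists P, integral_patch P /\ P x.

Definition null_structure : Prop :=
  [/\ forall x, U x ->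
        [/\ \dim (N x) = m.+1, (x <= N x)%VS & totally_null (N x)],
      holomorphic_distribution & integrable_distribution].

Definition arises_from (W : set {vspace S}) : Prop :=
  (forall x, U x ->
     exists z, W `&` hat x = [set z] /\ N x = check z) /\
  (forall L, leaf L <->
     exists z, W z /\ L = [set x | U x /\ (x <= check z)%VS]).

End Distribution.

(* W, a set of points of P(S), is an embedded complex submanifold: its cone is
   locally the zero set of a submersion.  PT being an embedded submanifold of
   P(S), the submanifolds of PT are those of P(S) contained in PT. *)
Definition submanifold (W : set {vspace S}) : Prop :=
  exists r : nat, forall Z0 : S, Z0 != 0 -> W <[Z0]>%VS ->
  exists F : S -> 'rV[C]_r, \forall Z \near Z0,
    [/\ differentiable F Z, \dim (limg (linfun ('d F Z))) = r
      & W <[Z]>%VS <-> F Z = 0].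

Definition complement_of (Xi : S) : set {vspace V} :=
  [set x | quadric x /\ ~~ (x <= ann' Xi)%VS].

Definition twistor_locus (Xi : S) : set {vspace S} :=
  [set z | hatU (complement_of Xi) z /\
     forall k : nat, (k < m)%N -> k = m %[mod 2] ->
     forall v : 'I_k -> V, Gamma (vpick z) Xi v = 0].

End Spinors.

(* Main.v *)
Require Import Defs.
From HB Require Import structures.
From mathcomp Require Import all_boot all_order all_algebra all_fingroup.
From mathcomp Require Import complex.
From mathcomp Require Import all_classical all_reals all_analysis.
From mathcomp Require Import ring zify.
Import Order.TTheory GRing.Theory Num.Theory.
Import numFieldNormedType.Exports.
Local Open Scope ring_scope.
Local Open Scope classical_set_scope.

(** Write B for the annihilator of Xi, a totally null subspace of dimension
    p = m + 1, and let tw X in S be the Clifford product of X in V with Xi, so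
    that tw X = 0 exactly for X in B.

    For X null and outside B, Clifford anticommutation shows that tw X is
    annihilated by X and by the part of B orthogonal to X. Together these span a
    totally null subspace of dimension p, so tw X is pure with this subspace as
    annihilator ([ann_tw]). Moving a tangent vector past X in the definition of
    the distribution identifies the annihilator of xi at x = <X> with that of
    tw X ([annihilator_line]). So the leaf through x is the alpha-plane of tw X,
    which meets B in dimension m. The vectors X + b, with b in B orthogonal to X,
    parametrise this plane near x, and the distribution is constant along it
    ([affine_patch]).

    The twistor locus is the projectivisation of the linear space of all spinors
    tw X ([locus_line]), since every vector outside B is null after adding a
    vector of B ([null_lift]). If a spinor Z shares an m-dimensional space of
    annihilating vectors with Xi, the forms Gamma^(k)(Z, Xi) with k < m vanish:
    on any k vectors, choose a common annihilating vector b orthogonal to all of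
    them, and use that two spinors annihilated by the same non-zero vector are
    orthogonal for the invariant form ([Gamma_dim_eq0]). Conversely expand Z in
    the Fock basis f_I Xi, where f is a null family dual to a basis of B. The
    coefficient of I is read off by pairing f_J Z with Xi for J the complement of
    I. The vanishing of the forms, together with the chirality of Z, leaves only
    the terms f_i Xi ([Gamma_eq0_tw]). In particular the locus is a submanifold:
    its cone is the kernel of a surjective linear map.

    Leaves are maximal connected integral manifolds. Any two points of a plane of
    the locus lie in one affine patch, so its part in U is a connected integral
    manifold. Along an arbitrary integral patch phi the derivatives of
    Z = tw (phi) are multiples of Z; restricted to a ray, the entries of
    Z Z^* / |Z|^2 then have zero derivative, so <Z>, and with it the distribution,
    is constant on the patch ([proj_constant], [patch_distribution]). Hence no
    connected integral manifold leaves the plane in which it starts.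

    In a standard chart xi is represented by - Y X Xi / 2, which is affine in
    the coordinates, and the conformal Killing equation is one more use of the
    Clifford relation. The chirality axiom fixes the sign of the volume element,
    which makes the planes self-dual: evaluate it on a pure spinor in a frame
    built from dual null bases ([vol_dual_basis]). *)

Set Implicit Arguments.
Unset Strict Implicit.
Unset Printing Implicit Defensive.
(** * Products of pairwise anticommuting elements *)

Lemma prod_anticomm_lift (A : pzRingType) (k : nat) (q : 'I_k.+1 -> A)
    (j : 'I_k.+1) :
  (forall i i', i != i' -> q i * q i' = - (q i' * q i)) ->
  q j * \prod_(i < k) q (lift j i) = (-1) ^+ j * \prod_(i < k.+1) q i.
Proof.
elim: k q j => [|k IH] q j q_anti.
  by rewrite ord1 big_ord0 big_ord1 expr0 mulr1 mul1r.
case: (unliftP ord0 j) => [j'|] ->; last first.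
  rewrite expr0 mul1r [RHS]big_ord_recl; congr (_ * _).
rewrite big_ord_recl [in RHS]big_ord_recl.
have -> : lift (lift ord0 j') ord0 = ord0 by apply/val_inj.
rewrite mulrA q_anti // mulNr -mulrA.
under eq_bigr => i _.
  have -> : lift (lift ord0 j') (lift ord0 i) = lift ord0 (lift j' i).
    by apply/val_inj; rewrite /= /bump /= !add1n ltnS; case: (j' <= i)%N.
  over.
rewrite (IH (fun i => q (lift ord0 i))); last first.
  by move=> i i' ne; apply: q_anti; rewrite (inj_eq (@lift_inj _ _)).
rewrite mulrA (commr_sign (q ord0)) -mulrA.
by rewrite (_ : lift ord0 j' = j'.+1 :> nat) // exprS mulN1r mulNr.
Qed.

Lemma prod_anticomm_perm (A : pzRingType) (k : nat) (q : 'I_k -> A)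
    (s : 'S_k) :
  (forall i i', i != i' -> q i * q i' = - (q i' * q i)) ->
  \prod_(i < k) q (s i) = (-1) ^+ s * \prod_(i < k) q i.
Proof.
elim: k q s => [|k IH] q s q_anti.
  by rewrite !big_ord0 (permS0 s) odd_perm1 mulr1.
pose j := s ord0.
have s_neq i : j != s (lift ord0 i).
  by rewrite /j (inj_eq (@perm_inj _ s)) neq_lift.
pose t0 i := odflt i (unlift j (s (lift ord0 i))).
have t0E i : s (lift ord0 i) = lift j (t0 i).
  by rewrite /t0; have [i' -> ->] := unlift_some (s_neq i).
have t0_inj : injective t0.
  move=> i i' eq_t; apply: (@lift_inj _ ord0); apply: (@perm_inj _ s).
  by rewrite !t0E eq_t.
have s_lift : s = lift_perm ord0 j (perm t0_inj).
  apply/permP => i; case: (unliftP ord0 i) => [i'|] ->; last by rewrite lift_perm_id.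
  by rewrite lift_perm_lift permE t0E.
rewrite big_ord_recl -/j.
under eq_bigr => i _ do rewrite t0E -(permE t0_inj).
rewrite (IH (fun i => q (lift j i))); last first.
  by move=> i i' ne; apply: q_anti; rewrite (inj_eq (@lift_inj _ _)).
rewrite mulrA (commr_sign (q j)) -mulrA prod_anticomm_lift //.
by rewrite mulrA s_lift odd_lift_perm /= addbC signr_addb signr_odd.
Qed.

(** The skew-symmetrised product in a basis of anticommuting elements: as in
    the Cauchy-Binet expansion only the bijective multi-indices survive, and
    each of them contributes the same product. *)
Lemma skew_prod_basis (C : numFieldType) (n k : nat) (P : 'M[C]_k)
    (q M : 'I_k -> 'M[C]_n) :
  (forall i j, i != j -> q i * q j = - (q j * q i)) ->
  (forall i, M i = \sum_j P i j *: q j) ->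
  skew_prod M = \det P *: \prod_(i < k) q i.
Proof.
move=> q_anti ME; rewrite /skew_prod.
have prodZ (s : 'S_k) : \prod_(i < k) M (s i)
    = \sum_(f : {ffun 'I_k -> 'I_k})
        (\prod_i P (s i) (f i)) *: \prod_i q (f i).
  under eq_bigr => i _ do rewrite ME.
  rewrite bigA_distr_bigA; apply: eq_bigr => f _.
  elim/big_rec3: _ => [|i x y z _ ->]; first by rewrite scale1r.
  by rewrite -[LHS]/(_ *m _) -scalemxAl -scalemxAr scalerA.
have detE (f : {ffun 'I_k -> 'I_k}) :
    \sum_(s : 'S_k) (-1) ^+ s * \prod_i P (s i) (f i)
    = \det (\matrix_(i, j) P j (f i)).
  by apply: eq_bigr => s _; congr (_ * _); apply: eq_bigr => i _; rewrite mxE.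
under eq_bigr => s _.
  rewrite prodZ scaler_sumr; under eq_bigr => f _ do rewrite scalerA; over.
rewrite exchange_big /=; under eq_bigr => f _ do rewrite -scaler_suml detE.
rewrite (bigID (fun f : {ffun 'I_k -> 'I_k} => injectiveb f)) /=.
rewrite [X in _ + X]big1 ?addr0; last first.
  move=> f /injectivePn [i [j ne eqf]].
  by rewrite (determinant_alternate ne) ?scale0r // => l; rewrite !mxE eqf.
rewrite (reindex (@pval _)) /=; last first.
  pose in_Sn := insubd (1%g : 'S_k).
  by exists in_Sn => /= f Uf; first apply: val_inj; apply: insubdK.
rewrite (eq_big xpredT (fun=> \det P *: \prod_(i < k) q i)); first last.
- move=> s _; have -> : \matrix_(i, j) P j (pval s i) = row_perm s P^T.
    by apply/matrixP => i j; rewrite !mxE pvalE.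
  under eq_bigr => i _ do rewrite pvalE.
  rewrite prod_anticomm_perm // row_permE det_mulmx det_perm det_tr.
  rewrite mulr_sign; case: (s : bool).
    by rewrite expr1 mulN1r scalerN scaleNr opprK.
  by rewrite expr0 mul1r.
- by move=> s; rewrite (valP s).
rewrite sumr_const card_Sn.
rewrite -[X in _ *: X]scaler_nat [LHS]scalerA mulVf ?scale1r //.
Qed.

Lemma skew_prod_anticomm (C : numFieldType) (n k : nat) (q : 'I_k -> 'M[C]_n) :
  (forall i j, i != j -> q i * q j = - (q j * q i)) ->
  skew_prod q = \prod_(i < k) q i.
Proof.
move=> q_anti; rewrite (skew_prod_basis (P := 1%:M) q_anti) ?det1 ?scale1r //.
move=> i; rewrite (bigD1 i) //= big1 => [|j ne]; rewrite mxE.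
  by rewrite eqxx scale1r addr0.
by rewrite eq_sym (negPf ne) scale0r.
Qed.

(** * Clifford multiplication *)

Lemma linfunE (K : fieldType) (aT rT : vectType K) (f : aT -> rT) :
  linear f -> linfun f =1 f.
Proof.
move=> f_lin v.
pose Hf := GRing.isLinear.Build _ _ _ _ f f_lin.
pose F : {linear aT -> rT} := HB.pack f Hf.
exact: (lfunE F).
Qed.

Section Clifford.
Context {C : numClosedFieldType} {m : nat} (D : spin_space C m).
Local Notation V := (vect C m).
Local Notation S := (spinor C m).
Local Notation T := 'cV[C]_(2 ^ m + 2 ^ m).
Local Notation hf := (hform D).

(** Clifford multiplication by v on the full spinor space S (+) S'. *)
Definition dg (v : V) : 'M[C]_(2 ^ m + 2 ^ m) := dirac_gen (cl D v) (cl' D v).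

Lemma hform_linear u : linear (fun v => hf u v : C^o).
Proof. by move=> a v w; rewrite /hform linearP mulmxDr -scalemxAr !mxE. Qed.

Lemma hformC u v : hf u v = hf v u.
Proof.
rewrite /hform -[in LHS](trmxK (u *m _ *m _)) mxE !trmx_mul trmxK.
by rewrite ss_h_sym mulmxA.
Qed.

Lemma hformDr u v w : hf u (v + w) = hf u v + hf u w.
Proof. by have := hform_linear u 1 v w; rewrite !scale1r. Qed.

Lemma hform0r u : hf u 0 = 0.
Proof. by rewrite /hform trmx0 mulmx0 mxE. Qed.

Lemma hformZr a u v : hf u (a *: v) = a * hf u v.
Proof. by have := hform_linear u a v 0; rewrite !addr0 hform0r addr0. Qed.

Lemma hformDl u v w : hf (u + v) w = hf u w + hf v w.
Proof. by rewrite !(hformC _ w) hformDr. Qed.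

Lemma hformZl a u v : hf (a *: u) v = a * hf u v.
Proof. by rewrite !(hformC _ v) hformZr. Qed.

Lemma hformNr u v : hf u (- v) = - hf u v.
Proof. by rewrite -scaleN1r hformZr mulN1r. Qed.

Lemma hformBr u v w : hf u (v - w) = hf u v - hf u w.
Proof. by rewrite hformDr hformNr. Qed.

Lemma hform_sumr (I : finType) (P : pred I) u (v : I -> V) :
  hf u (\sum_(i | P i) v i) = \sum_(i | P i) hf u (v i).
Proof.
by elim/big_rec2: _ => [|i x y _ <-]; rewrite ?hform0r ?hformDr.
Qed.

Lemma hform_rowE k l (E : 'M[C]_(k, m.+1 + m.+1)) (F : 'M[C]_(l, m.+1 + m.+1))
    i j : (E *m ss_h D *m F^T) i j = hf (row i E) (row j F).
Proof.
rewrite /hform tr_row -row_mul [LHS]mxE [RHS]mxE; apply: eq_bigr => a _.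
by rewrite [row _ _ _ _]mxE [col _ _ _ _]mxE.
Qed.

Lemma hform_nondeg u : (forall v, hf u v = 0) -> u = 0.
Proof.
move=> u0; have: u *m ss_h D = 0.
  apply/rowP => j; have := u0 (delta_mx 0 j).
  by rewrite /hform trmx_delta -colE !mxE.
by move/(congr1 (mulmx^~ (invmx (ss_h D)))); rewrite mulmxK ?ss_h_nondeg // mul0mx.
Qed.

Lemma cl_linear : linear (cl D).
Proof.
move=> a u v; rewrite /cl scaler_sumr -big_split /=; apply: eq_bigr => i _.
by rewrite !mxE scalerDl scalerA.
Qed.

Lemma cl'_linear : linear (cl' D).
Proof.
move=> a u v; rewrite /cl' scaler_sumr -big_split /=; apply: eq_bigr => i _.
by rewrite !mxE scalerDl scalerA.
Qed.

Lemma dg_linear : linear dg.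
Proof.
move=> a u v; rewrite /dg /dirac_gen cl_linear cl'_linear.
by rewrite scale_block_mx add_block_mx !scaler0 !addr0.
Qed.

Lemma dgE v : dg v = \sum_a v 0 a *: dirac_gen (gam D a) (gam' D a).
Proof.
rewrite /dg /cl /cl' /dirac_gen.
elim/big_rec3: _ => [|a x y z _ <-]; first by rewrite /dirac_gen block_mx0.
by rewrite scale_block_mx add_block_mx !scaler0 !addr0.
Qed.

Lemma dgD u v : dg (u + v) = dg u + dg v.
Proof. by rewrite -[u]scale1r dg_linear !scale1r. Qed.

Lemma dg0 : dg 0 = 0.
Proof. by apply: (addrI (dg 0)); rewrite -dgD !addr0. Qed.

Lemma dgZ a u : dg (a *: u) = a *: dg u.
Proof. by rewrite -[a *: u]addr0 dg_linear dg0 addr0. Qed.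

Lemma dgN u : dg (- u) = - dg u.
Proof. by rewrite -scaleN1r dgZ scaleN1r. Qed.

Lemma dgB u v : dg (u - v) = dg u - dg v.
Proof. by rewrite dgD dgN. Qed.

Lemma dg_sum (I : finType) (P : pred I) (v : I -> V) :
  dg (\sum_(i | P i) v i) = \sum_(i | P i) dg (v i).
Proof. by elim/big_rec2: _ => [|i x y _ <-]; rewrite ?dg0 ?dgD. Qed.

Lemma dg_clifford u v : dg u *m dg v + dg v *m dg u = (- (2 * hf u v))%:M.
Proof.
pose G a := dirac_gen (gam D a) (gam' D a).
have dgM w z : dg w *m dg z = \sum_a \sum_b (w 0 a * z 0 b) *: (G a *m G b).
  rewrite !dgE mulmx_suml; apply: eq_bigr => a _.
  rewrite mulmx_sumr; apply: eq_bigr => b _.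
  by rewrite -scalemxAl -scalemxAr scalerA.
have GG a b : G a *m G b + G b *m G a = (- (2 * ss_h D a b))%:M.
  rewrite (_ : (- _)%:M = 2 *: (- ss_h D a b)%:M); last first.
    by rewrite scale_scalar_mx mulrN.
  by rewrite -(ss_clifford D a b) scalerA mulfV ?scale1r ?pnatr_eq0.
rewrite !dgM [X in _ + X]exchange_big -big_split /=.
transitivity (\sum_a \sum_b (- (2 * (u 0 a * v 0 b * ss_h D a b)))%:M
              : 'M[C]_(2 ^ m + 2 ^ m)).
  apply: eq_bigr => a _; rewrite -big_split; apply: eq_bigr => b _ /=.
  rewrite [X in _ + X *: _]mulrC -scalerDr GG scale_scalar_mx.
  by congr (_%:M); ring.
rewrite exchange_big; under eq_bigr => b _ do rewrite -raddf_sum.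
rewrite -raddf_sum; congr (_%:M).
rewrite /hform mxE mulr_sumr -sumrN; apply: eq_bigr => b _.
rewrite !mxE mulr_suml mulr_sumr -sumrN; apply: eq_bigr => a _; ring.
Qed.

Lemma dg_sq u : dg u *m dg u = (- hf u u)%:M.
Proof.
have := dg_clifford u u; rewrite -mulr2n -scaler_nat => /(congr1 ( *:%R 2^-1)).
rewrite scalerA mulVf ?pnatr_eq0 // scale1r => ->.
by rewrite scale_scalar_mx; congr (_%:M); rewrite mulrN mulKf ?pnatr_eq0.
Qed.

Lemma dg_anti u v : hf u v = 0 -> dg u *m dg v = - (dg v *m dg u).
Proof.
move=> uv0; apply/eqP; rewrite -addr_eq0 dg_clifford uv0 mulr0 oppr0.
by rewrite raddf0.
Qed.

(** The vectors annihilating a spinor of S (+) S'. *)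
Definition dann (s : T) : {vspace V} := lker (linfun (fun v : V => dg v *m s)).

Lemma mem_dann s v : (v \in dann s) = (dg v *m s == 0).
Proof.
rewrite memv_ker linfunE // => a u w.
by rewrite dg_linear mulmxDl scalemxAl.
Qed.

Lemma mem_ann Z v : (v \in ann D Z) = (cl D v *m Z == 0).
Proof.
rewrite memv_ker linfunE // => a u w.
by rewrite cl_linear mulmxDl scalemxAl.
Qed.

Lemma mem_ann' Z v : (v \in ann' D Z) = (cl' D v *m Z == 0).
Proof.
rewrite memv_ker linfunE // => a u w.
by rewrite cl'_linear mulmxDl scalemxAl.
Qed.

Lemma mem_perp X v : (v \in perp D X) = (hf X v == 0).
Proof. by rewrite memv_ker linfunE //; exact: hform_linear. Qed.

Lemma dg_S v (Z : S) : dg v *m col_mx Z 0 = col_mx 0 (cl D v *m Z).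
Proof. by rewrite /dg /dirac_gen mul_block_col !mul0mx !mulmx0 !addr0. Qed.

Lemma dg_S' v (Xi : S) : dg v *m col_mx 0 Xi = col_mx (cl' D v *m Xi) 0.
Proof. by rewrite /dg /dirac_gen mul_block_col !mul0mx !mulmx0 !addr0 add0r. Qed.

Lemma ann_dann Z : ann D Z = dann (col_mx Z 0).
Proof.
apply/vspaceP => v.
by rewrite mem_ann mem_dann dg_S col_mx_eq0 eqxx.
Qed.

Lemma ann'_dann Xi : ann' D Xi = dann (col_mx 0 Xi).
Proof.
apply/vspaceP => v.
by rewrite mem_ann' mem_dann dg_S' col_mx_eq0 eqxx andbT.
Qed.

Lemma dann_null s : s != 0 -> totally_null D (dann s).
Proof.
move=> s0 u v; rewrite !mem_dann => /eqP us /eqP vs.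
have := congr1 (mulmx^~ s) (dg_clifford u v).
rewrite mulmxDl -!mulmxA us vs !mulmx0 addr0 mul_scalar_mx => /esym/eqP.
by rewrite scaler_eq0 (negPf s0) orbF oppr_eq0 mulf_eq0 pnatr_eq0 => /eqP.
Qed.

Lemma ann_null Z : Z != 0 -> totally_null D (ann D Z).
Proof. by move=> Z0; rewrite ann_dann; apply: dann_null; rewrite col_mx_eq0 negb_and Z0. Qed.

Lemma ann'_null Xi : Xi != 0 -> totally_null D (ann' D Xi).
Proof.
move=> Xi0; rewrite ann'_dann; apply: dann_null.
by rewrite col_mx_eq0 negb_and Xi0 orbT.
Qed.

(** * Maximal totally null subspaces *)

(** The rows of a matrix form a basis of A. *)
Lemma vspace_rowbasis (A : {vspace V}) (k : nat) : \dim A = k ->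
  exists2 E : 'M[C]_(k, m.+1 + m.+1), row_free E
    & forall v, v \in A <-> exists u, v = u *m E.
Proof.
move=> <-; pose E := \matrix_(i < \dim A) (vbasis A)`_i.
have uE u : u *m E = \sum_i u 0 i *: (vbasis A)`_i.
  by rewrite mulmx_sum_row; apply: eq_bigr => i _; rewrite rowK.
exists E => [|v].
  rewrite -kermx_eq0; apply/eqP/row_matrixP => i; rewrite row0.
  have /sub_kermxP := row_sub i (kermx E); rewrite uE => u0.
  have /freeP/(_ _ u0) := basis_free (vbasisP A) => u00.
  by apply/rowP => j; rewrite u00 mxE.
split=> [vA|[u ->]]; last first.
  rewrite uE; apply: memv_suml => i _; apply: memvZ.
  by apply: vbasis_mem; apply: mem_nth; rewrite size_tuple.
exists (\row_i coord (vbasis A) i v).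
rewrite uE [LHS](coord_vbasis vA); apply: eq_bigr => i _.
by rewrite mxE.
Qed.

(** A maximal totally null subspace has a basis E with a null dual family F. *)
Lemma dual_basis (A : {vspace V}) : \dim A = m.+1 -> totally_null D A ->
  exists E F : 'M[C]_(m.+1, m.+1 + m.+1),
    [/\ forall v, v \in A <-> exists u, v = u *m E,
        E *m ss_h D *m E^T = 0, F *m ss_h D *m F^T = 0
      & E *m ss_h D *m F^T = 1%:M].
Proof.
move=> dimA nullA; have [E freeE spanE] := vspace_rowbasis dimA.
have rowE i : row i E \in A by apply/spanE; exists (delta_mx 0 i); rewrite rowE.
have EE : E *m ss_h D *m E^T = 0.
  by apply/matrixP => i j; rewrite hform_rowE nullA // mxE.
have /row_freeP [G EG] : row_free (E *m ss_h D).
  by rewrite /row_free mxrankMfree ?row_free_unit ?ss_h_nondeg.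
pose s := G^T *m ss_h D *m G.
have sT : s^T = s by rewrite /s !trmx_mul trmxK ss_h_sym mulmxA.
have GE : G^T *m ss_h D *m E^T = 1%:M.
  by apply: trmx_inj; rewrite !trmx_mul !trmxK ss_h_sym mulmxA EG trmx1.
have FT : (G^T - 2^-1 *: (s *m E))^T = G - 2^-1 *: (E^T *m s).
  by apply/matrixP => i j; rewrite -[in RHS]sT -trmx_mul !mxE.
(* F = G^T - s E / 2 removes the self-pairing s of G^T *)
exists E, (G^T - 2^-1 *: (s *m E)); split => //.
  rewrite FT !mulmxBl !mulmxBr -/s -?scalemxAl -?scalemxAr.
  rewrite !mulmxA GE -!(mulmxA s) EG EE mulmx1 !mul1mx.
  rewrite ?(mul0mx, mulmx0) !scaler0 subr0.
  by apply/matrixP => i j; rewrite !mxE; field; rewrite ?pnatr_eq0.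
rewrite FT mulmxBr EG -scalemxAr mulmxA EE.
by rewrite mul0mx scaler0 subr0.
Qed.

(** The coordinates in a basis E, F of dual null families. *)
Lemma dual_basisE (E F : 'M[C]_(m.+1, m.+1 + m.+1)) :
  E *m ss_h D *m E^T = 0 -> F *m ss_h D *m F^T = 0 ->
  E *m ss_h D *m F^T = 1%:M ->
  forall (k : nat) (X : 'M[C]_(k, m.+1 + m.+1)),
    X = X *m ss_h D *m F^T *m E + X *m ss_h D *m E^T *m F.
Proof.
move=> EE FF EF k X; pose M := col_mx E F; pose J : 'M[C]_(m.+1 + m.+1) := row_mx F^T E^T.
have FE : F *m ss_h D *m E^T = 1%:M.
  by apply: trmx_inj; rewrite !trmx_mul !trmxK ss_h_sym mulmxA EF trmx1.
have MJ : M *m (ss_h D *m J) = 1%:M.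
  by rewrite mulmxA mul_col_mx mul_col_row EF EE FF FE -scalar_mx_block.
rewrite -[LHS]mulmx1 -(mulmx1C MJ) !mulmxA.
by rewrite mul_mx_row mul_row_col.
Qed.

(** A totally null subspace of maximal dimension is its own orthogonal. *)
Lemma null_maximal (A : {vspace V}) (X : V) : \dim A = m.+1 ->
  totally_null D A -> (forall v, v \in A -> hf X v = 0) -> X \in A.
Proof.
move=> dimA nullA XA; have [E [F [spanE EE FF EF]]] := dual_basis dimA nullA.
have XE : X *m ss_h D *m E^T = 0.
  apply/rowP => j; rewrite -(ord1 0) hform_rowE row_id mxE; apply: XA.
  by apply/spanE; exists (delta_mx 0 j); rewrite rowE.
apply/spanE; exists (X *m ss_h D *m F^T).
by rewrite {1}(dual_basisE EE FF EF X) XE mul0mx addr0.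
Qed.

Lemma null_maximal_eq (A A' : {vspace V}) : \dim A = m.+1 ->
  totally_null D A' -> (A <= A')%VS -> A' = A.
Proof.
move=> dimA nullA' sAA'; apply/eqP; rewrite eqEsubv sAA' andbT.
apply/subvP => v vA'; apply: null_maximal => // [u w uA wA|w wA].
  by apply: nullA'; apply: (subvP sAA').
by apply: nullA' => //; apply: (subvP sAA').
Qed.

Lemma dim_cap_perp (B : {vspace V}) (X b : V) : b \in B -> hf X b != 0 ->
  (\dim (B :&: perp D X)).+1 = \dim B.
Proof.
move=> bB Xb; set f := linfun (fun v : V => hf X v : C^o).
rewrite /perp -/f -(limg_ker_dim f B) -addn1; congr (_ + _)%N.
have fb : f b = hf X b by rewrite /f linfunE //; apply: hform_linear.
apply/eqP; rewrite eqn_leq (leq_trans (dimvS (subvf _))) ?dimvf //=.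
rewrite ?andbT lt0n dimv_eq0; apply/eqP => f0.
by have := memv_img f bB; rewrite f0 memv0 fb (negPf Xb).
Qed.

Lemma dim_add_line (A : {vspace V}) (X : V) : X \notin A ->
  \dim (<[X]> + A)%VS = (\dim A).+1.
Proof.
move=> XA; rewrite dimv_disjoint_sum.
  by rewrite dim_vline; case: eqP XA => // ->; rewrite mem0v.
apply/eqP; rewrite -subv0; apply/subvP => v; rewrite memv_cap => /andP[/vlineP[k ->]].
by rewrite rpredZeq (negPf XA) orbF => /eqP ->; rewrite scale0r mem0v.
Qed.
End Clifford.

(** * The spinors obtained from a pure spinor by Clifford multiplication *)

Lemma line_vpick (K : fieldType) (vT : vectType K) (x : {vspace vT}) :
  \dim x = 1%N -> x = <[vpick x]>%VS.
Proof.
move=> dimx; apply/esym/eqP; rewrite eqEdim -memvE memv_pick dim_vline dimx vpick0.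
by rewrite -dimv_eq0 dimx.
Qed.

Lemma vpick_line (K : fieldType) (vT : vectType K) (v : vT) :
  v != 0 -> exists2 c, c != 0 & vpick <[v]>%VS = c *: v.
Proof.
move=> v0; have /vlineP[c vE] := memv_pick <[v]>; exists c => //.
apply: contra_neq v0 => c0; apply/eqP; rewrite -memv0 memvE subv0 -vpick0.
by rewrite vE c0 scale0r.
Qed.

Lemma vline_scale (K : fieldType) (vT : vectType K) (c : K) (v : vT) :
  c != 0 -> <[c *: v]>%VS = <[v]>%VS.
Proof.
move=> c0; apply/eqP; rewrite eqEsubv -!memvE memvZ ?memv_line //=.
by apply/vlineP; exists c^-1; rewrite scalerA mulVf ?scale1r.
Qed.

Lemma vline_eqP (K : fieldType) (vT : vectType K) (u v : vT) :
  u != 0 -> u \in <[v]>%VS -> <[u]>%VS = <[v]>%VS.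
Proof.
move=> u0 /vlineP[c uE]; rewrite uE vline_scale //.
by apply: contra_neq u0 => c0; rewrite uE c0 scale0r.
Qed.

Section PureSpinor.
Context {C : numClosedFieldType} {m : nat} (D : spin_space C m).
Local Notation V := (vect C m).
Local Notation S := (spinor C m).
Local Notation hf := (hform D).

Lemma ann_scale (c : C) (Z : S) : c != 0 -> ann D (c *: Z) = ann D Z.
Proof.
move=> c0; apply/vspaceP => v; rewrite !mem_ann -scalemxAr scaler_eq0.
by rewrite (negPf c0).
Qed.

Lemma check_line (Z : S) : Z != 0 -> check D <[Z]>%VS = ann D Z.
Proof. by move=> /vpick_line[c c0 cE]; rewrite /check cE ann_scale. Qed.

Lemma quadric_line (X : V) : X != 0 -> quadric D <[X]>%VS <-> hf X X = 0.
Proof.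
move=> X0; split=> [[_ nullX]|XX]; first by apply: nullX; apply: memv_line.
split=> [|u v /vlineP[a ->] /vlineP[b ->]]; first by rewrite dim_vline X0.
by rewrite hformZl hformZr XX !mulr0.
Qed.

Variable Xi : S.
Hypothesis hXi : pure' D Xi.
Let B := ann' D Xi.

Let dimB : \dim B = m.+1. Proof. by case: hXi. Qed.
Let nullB : totally_null D B. Proof. by case: hXi => Xi0 _; apply: ann'_null. Qed.

(** Clifford multiplication of the pure spinor Xi by X. *)
Definition tw (X : V) : S := cl' D X *m Xi.

Lemma tw_linear : linear tw.
Proof. by move=> a u v; rewrite /tw cl'_linear mulmxDl -scalemxAl. Qed.

Lemma tw_eq0 X : (tw X == 0) = (X \in B).
Proof. by rewrite mem_ann'. Qed.

Lemma twZ a X : tw (a *: X) = a *: tw X.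
Proof.
have tw0 : tw 0 = 0 by apply/eqP; rewrite tw_eq0 mem0v.
by rewrite -[a *: X]addr0 tw_linear tw0 addr0.
Qed.

Lemma twD X Y : tw (X + Y) = tw X + tw Y.
Proof. by rewrite -[X in LHS]scale1r tw_linear scale1r. Qed.

Lemma twDr X b : b \in B -> tw (X + b) = tw X.
Proof. by rewrite -tw_eq0 => /eqP b0; rewrite twD b0 addr0. Qed.

Lemma cl_tw u v : cl D u *m tw v = - (2 * hf u v) *: Xi - cl D v *m tw u.
Proof.
apply/eqP; rewrite eq_sym subr_eq eq_sym; apply/eqP.
have := congr1 (mulmx^~ (col_mx 0 Xi)) (dg_clifford D u v).
rewrite mulmxDl -!mulmxA !dg_S' !dg_S add_col_mx addr0 mul_scalar_mx scale_col_mx.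
by case/eq_col_mx.
Qed.

Lemma cl_tw_null X : hf X X = 0 -> cl D X *m tw X = 0.
Proof.
move=> XX; have := cl_tw X X; rewrite XX mulr0 oppr0 scale0r sub0r => /eqP.
rewrite -addr_eq0 -mulr2n -scaler_nat scaler_eq0 pnatr_eq0 /= => /eqP. exact.
Qed.

Lemma null_not_perp X : X \notin B -> exists2 b, b \in B & hf X b != 0.
Proof.
move=> XB; apply: contrapT => no_b; case/negP: XB.
apply: null_maximal dimB nullB _ => v vB.
by apply/eqP; apply: contrapT => /negP Xv; apply: no_b; exists v.
Qed.

(** The pure spinor tw X is annihilated by X and by the part of B that is
    orthogonal to X. *)
Lemma ann_tw X : hf X X = 0 -> X \notin B ->
  ann D (tw X) = (<[X]> + (B :&: perp D X))%VS
  /\ \dim (ann D (tw X)) = m.+1.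
Proof.
move=> XX XB; set A := (<[X]> + _)%VS.
have [b bB Xb] := null_not_perp XB.
have dimA : \dim A = m.+1.
  rewrite dim_add_line; last by rewrite memv_cap negb_and XB.
  by rewrite (dim_cap_perp bB Xb).
have sA : (A <= ann D (tw X))%VS.
  rewrite subv_add -memvE mem_ann cl_tw_null // eqxx /=.
  apply/subvP => v; rewrite memv_cap => /andP[vB]; rewrite mem_perp => /eqP Xv.
  rewrite mem_ann.
  have tv0 : tw v = 0 by apply/eqP; rewrite tw_eq0.
  by rewrite cl_tw (hformC D v X) Xv mulr0 oppr0 scale0r tv0 mulmx0 subr0.
have nullZ : totally_null D (ann D (tw X)) by apply: ann_null; rewrite tw_eq0.
by rewrite (null_maximal_eq dimA nullZ sA).
Qed.

Lemma complement_line X : complement_of D Xi <[X]>%VS <->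
  hf X X = 0 /\ X \notin B.
Proof.
have [->|X0] := eqVneq X 0.
  split=> [[[]]|[_]]; last by rewrite mem0v.
  by rewrite dim_vline eqxx.
by rewrite /complement_of /= quadric_line // -memvE.
Qed.

Lemma complement_lineP x : complement_of D Xi x ->
  exists X, [/\ x = <[X]>%VS, hf X X = 0 & X \notin B].
Proof.
move=> Ux; have := Ux; have [[/line_vpick xE _] _] := Ux.
by rewrite xE => /complement_line[XX XB]; exists (vpick x).
Qed.

(** Where xi does not vanish, its annihilator at <X> is that of the spinor tw X. *)
Lemma annihilator_line X : hf X X = 0 -> X \notin B ->
  annihilator D (component Xi) <[X]>%VS = ann D (tw X).
Proof.
move=> XX XB; have X0 : X != 0 by apply: contraNneq XB => ->; rewrite mem0v.
have [c c0 cE] := vpick_line X0; rewrite /annihilator cE /component.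
apply/vspaceP => v; rewrite memv_cap mem_perp hformZl mulf_eq0 (negPf c0) /=.
rewrite memv_ker linfunE; last first.
  by move=> a u w; rewrite -!/(tw _) tw_linear mulmxDr -scalemxAr.
rewrite -/(tw v) cl_tw twZ -scalemxAr hformZl.
apply/andP/idP => [[/eqP Xv]|vX].
  by rewrite Xv !mulr0 oppr0 scale0r sub0r oppr_eq0 scaler_eq0 (negPf c0) mem_ann.
have XinN : X \in ann D (tw X) by rewrite mem_ann cl_tw_null.
have Xv : hf X v = 0 by apply: ann_null XinN vX; rewrite tw_eq0.
rewrite Xv !mulr0 oppr0 scale0r sub0r oppr_eq0 scaler_eq0 (negPf c0).
by rewrite -mem_ann vX.
Qed.

(** Modulo B every vector outside B is null. *)
Lemma null_lift X : X \notin B ->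
  exists Y, [/\ tw Y = tw X, hf Y Y = 0 & Y \notin B].
Proof.
move=> XB; have [b bB Xb] := null_not_perp XB.
(* h(X + k b, X + k b) = h(X, X) + 2 k h(X, b), as b is null. *)
pose Y := X + (- hf X X / (2 * hf X b)) *: b.
have YE : tw Y = tw X by rewrite twDr // memvZ.
exists Y; split=> //; last by rewrite -tw_eq0 YE tw_eq0.
rewrite /Y !hformDr !hformDl !hformZr !hformZl (nullB bB bB) (hformC D b X).
by field.
Qed.

(** A null vector X outside B that annihilates tw Y determines the line of tw Y. *)
Lemma tw_inj X Y : hf X X = 0 -> X \notin B -> Y \notin B ->
  X \in ann D (tw Y) -> <[tw Y]>%VS = <[tw X]>%VS.
Proof.
move=> XX XB YB; rewrite mem_ann => XY.
have [b bB Xb] := null_not_perp XB.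
pose Y' := Y + (- hf X Y / hf X b) *: b.
have Y'E : tw Y' = tw Y by rewrite twDr // memvZ.
have XY' : hf X Y' = 0 by rewrite /Y' hformDr hformZr; field.
have : Y' \in ann D (tw X).
  rewrite mem_ann cl_tw hformC XY' mulr0 oppr0 scale0r sub0r Y'E oppr_eq0.
  by rewrite XY.
rewrite (ann_tw XX XB).1 => /memv_addP[_ /vlineP[a ->] [v vBX Y'aE]].
have vB : v \in B by move: vBX; rewrite memv_cap => /andP[].
apply: vline_eqP; first by rewrite tw_eq0.
by apply/vlineP; exists a; rewrite -Y'E Y'aE twDr // twZ.
Qed.
End PureSpinor.

(** * The invariant form and the Fock basis of a pure spinor *)

Section Fock.
Context {C : numClosedFieldType} {m : nat} (D : spin_space C m).
Local Notation V := (vect C m).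
Local Notation S := (spinor C m).
Local Notation N := (2 ^ m + 2 ^ m)%N.
Local Notation T := 'cV[C]_N.
Local Notation hf := (hform D).
Local Notation dg := (dg D).

(** The spin-invariant bilinear form. *)
Definition beta (s t : T) : C := (s^T *m ss_form D *m t) 0 0.

(** The vectors that are not null span V. *)
Lemma nonnull_ind (P : V -> Prop) :
  (forall u, hf u u != 0 -> P u) -> (forall u v, P u -> P v -> P (u + v)) ->
  forall u, P u.
Proof.
move=> Pnn PD.
have [w ww] : exists w, hf w w != 0.
  apply: contrapT => no_w.
  have null w : hf w w = 0 by apply/eqP/negPn/negP => ww; apply: no_w; exists w.
  have: (delta_mx 0 0 : V) = 0.
    apply: (@hform_nondeg _ _ D) => v; have := null (delta_mx 0 0 + v).
    rewrite !hformDr !hformDl !null add0r addr0 (hformC D v) -mulr2n => /eqP.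
    by rewrite mulrn_eq0 /= => /eqP.
  by move/rowP/(_ 0)/eqP; rewrite !mxE !eqxx oner_eq0.
have Pscale k : k != 0 -> P (k *: w).
  by move=> k0; apply: Pnn; rewrite hformZl hformZr !mulf_neq0.
move=> u; have [uu|] := eqVneq (hf u u) 0; last exact: Pnn.
(* One of u + w and u - w is not null, since their squares add up to 2 h(w, w). *)
have Pu k : k != 0 -> hf (u + k *: w) (u + k *: w) != 0 -> P u.
  move=> k0 uk; rewrite -[u](addrK (k *: w)) -scaleNr; apply: PD; first exact: Pnn.
  by apply: Pscale; rewrite oppr_eq0.
have [u1|] := eqVneq (hf (u + 1 *: w) (u + 1 *: w)) 0; last by apply: Pu; rewrite oner_eq0.
apply: (Pu (-1)); first by rewrite oppr_eq0 oner_eq0.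
apply: contra_neq ww => u2.
have : 2 * hf w w = hf (u + 1 *: w) (u + 1 *: w) + hf (u + -1 *: w) (u + -1 *: w).
  by rewrite !hformDr !hformDl !hformZr !hformZl uu; ring.
by rewrite u1 u2 addr0 => /eqP; rewrite mulf_eq0 pnatr_eq0 /= => /eqP.
Qed.

(** Invariance under the products of two unit vectors says that uv has adjoint
    vu for unit vectors u, v, hence for all vectors by bilinearity. *)
Lemma form_adjoint u v :
  (dg u *m dg v)^T *m ss_form D = ss_form D *m (dg v *m dg u).
Proof.
have unit_case u1 v1 : hf u1 u1 = 1 -> hf v1 v1 = 1 ->
    (dg u1 *m dg v1)^T *m ss_form D = ss_form D *m (dg v1 *m dg u1).
  move=> u11 v11; rewrite -[in RHS](ss_form_inv u11 v11) -!dgE.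
  rewrite -[RHS]mulmxA -[X in _ = _ *m X]mulmxA (mulmxA (dg v1) (dg v1)) dg_sq v11.
  by rewrite mul_scalar_mx -scalemxAr dg_sq u11 scale_scalar_mx mulrNN mulr1 mulmx1.
have normalise u1 : hf u1 u1 != 0 ->
    exists k u2, u1 = k *: u2 /\ hf u2 u2 = 1.
  move=> u11; pose k := sqrtC (hf u1 u1).
  have k0 : k != 0 by rewrite sqrtC_eq0.
  exists k, (k^-1 *: u1); rewrite scalerA mulfV // scale1r; split=> //.
  by rewrite hformZl hformZr mulrA -expr2 exprVn sqrtCK mulVf.
elim/nonnull_ind: u => [u uu|u u' IH IH']; last first.
  by rewrite dgD !(mulmxDl, mulmxDr) [(_ + _)^T]raddfD mulmxDl IH IH'.
elim/nonnull_ind: v => [v vv|v v' IH IH']; last first.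
  by rewrite dgD !(mulmxDl, mulmxDr) [(_ + _)^T]raddfD mulmxDl IH IH'.
have [k [u1 [-> u11]]] := normalise u uu; have [l [v1 [-> v11]]] := normalise v vv.
have dgZZ a b w z : dg (a *: w) *m dg (b *: z) = (a * b) *: (dg w *m dg z).
  by rewrite !dgZ -scalemxAl -scalemxAr scalerA.
rewrite !dgZZ mulrC.
by rewrite [(_ *: _)^T]linearZ /= -scalemxAl -scalemxAr unit_case.
Qed.

Lemma beta_adjoint u v s t :
  beta (dg u *m (dg v *m s)) t = beta s (dg v *m (dg u *m t)).
Proof.
rewrite /beta mulmxA trmx_mul -[_^T *m _ *m ss_form D]mulmxA form_adjoint.
by rewrite !mulmxA.
Qed.

Lemma betaDl s s' t : beta (s + s') t = beta s t + beta s' t.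
Proof. by rewrite /beta [(_ + _)^T]raddfD !mulmxDl mxE. Qed.

Lemma betaZl a s t : beta (a *: s) t = a * beta s t.
Proof. by rewrite /beta [(_ *: _)^T]linearZ /= -!scalemxAl mxE. Qed.

Lemma beta_suml (I : finType) (P : pred I) (s : I -> T) t :
  beta (\sum_(i | P i) s i) t = \sum_(i | P i) beta (s i) t.
Proof.
elim/big_rec2: _ => [|i x y _ <-]; last by rewrite betaDl.
by rewrite /beta trmx0 !mul0mx mxE.
Qed.

Lemma beta_nondeg t : (forall s, beta s t = 0) -> t = 0.
Proof.
move=> t0; have: ss_form D *m t = 0.
  apply/colP => i; have := t0 (delta_mx i 0).
  by rewrite /beta trmx_delta -mulmxA -rowE !mxE.
by move/(congr1 (mulmx (invmx (ss_form D)))); rewrite mulKmx ?ss_form_nondeg // mulmx0.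
Qed.

(** Spinors with a common annihilating vector are orthogonal: for b, w with
    bw + wb = 1 one has beta (s, t) = beta (s, bwt) = beta (wbs, t) = 0. *)
Lemma beta_common_ann b s t : b != 0 -> dg b *m s = 0 -> dg b *m t = 0 ->
  beta s t = 0.
Proof.
move=> b0 bs bt.
have [w bw] : exists w, hf b w != 0.
  apply: contrapT => no_w; case/eqP: b0; apply: (@hform_nondeg _ _ D) => w.
  by apply/eqP/negPn/negP => bw; apply: no_w; exists w.
have tE : - (2 * hf b w) *: t = dg b *m (dg w *m t).
  have := congr1 (mulmx^~ t) (dg_clifford D b w).
  by rewrite mulmxDl -!mulmxA bt mulmx0 addr0 mul_scalar_mx => ->.
have : - (2 * hf b w) * beta s t = 0.
  have betaZr a : beta s (a *: t) = a * beta s t.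
    by rewrite /beta -scalemxAr mxE.
  by rewrite -betaZr tE -beta_adjoint bs mulmx0 /beta trmx0 !mul0mx mxE.
by move/eqP; rewrite mulf_eq0 oppr_eq0 mulf_eq0 pnatr_eq0 (negPf bw) => /eqP.
Qed.

(** The matrices that preserve the spinors annihilated by b. *)
Definition keeps (b : V) (M : 'M[C]_N) : Prop :=
  forall s : T, dg b *m s = 0 -> dg b *m (M *m s) = 0.

Lemma keeps_dg b v : hf b v = 0 -> keeps b (dg v).
Proof. by move=> bv s bs; rewrite mulmxA dg_anti // mulNmx -mulmxA bs mulmx0 oppr0. Qed.

Lemma keeps_prod b (I : Type) (r : seq I) (P : pred I) (M : I -> 'M[C]_N) :
  (forall i, P i -> keeps b (M i)) -> keeps b (\prod_(i <- r | P i) M i).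
Proof.
move=> bM; elim/big_ind: _ => // [s|M1 M2 b1 b2 s bs].
  by rewrite mul1mx.
by rewrite -mulmxA; apply: b1; apply: b2.
Qed.

Lemma keeps_skew_prod b k (M : 'I_k -> 'M[C]_N) :
  (forall i, keeps b (M i)) -> keeps b (skew_prod M).
Proof.
move=> bM s bs; rewrite /skew_prod -scalemxAl -scalemxAr mulmx_suml mulmx_sumr.
rewrite big1 ?scaler0 // => t _; rewrite -scalemxAl -scalemxAr.
by rewrite keeps_prod ?scaler0.
Qed.

Lemma Gamma_eq0 (k : nat) (Z Xi : S) (v : 'I_k -> V) b : b != 0 ->
  b \in ann D Z -> b \in ann' D Xi -> (forall i, hf b (v i) = 0) ->
  Gamma D Z Xi v = 0.
Proof.
rewrite ann_dann ann'_dann !mem_dann => b0 /eqP bZ /eqP bXi bv.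
apply: (@beta_common_ann b) => //; apply: keeps_skew_prod => // i.
exact: keeps_dg.
Qed.

(** Fewer than dim A vectors have a common orthogonal vector in A. *)
Lemma perp_family (A : {vspace V}) (k : nat) (v : 'I_k -> V) : (k < \dim A)%N ->
  exists b, [/\ b != 0, b \in A & forall i, hf b (v i) = 0].
Proof.
move=> kA; pose f b := \row_i hf (v i) b.
have fE : linfun f =1 f.
  apply: linfunE => a u w; apply/rowP => i; rewrite !mxE.
  by rewrite hformDr hformZr.
pose b := vpick (A :&: lker (linfun f)).
have b0 : b != 0.
  rewrite vpick0 -dimv_eq0 -lt0n -(ltn_add2r (\dim (linfun f @: A))) limg_ker_dim add0n.
  apply: leq_ltn_trans kA; apply: leq_trans (dimvS (subvf _)) _.
  by rewrite dimvf dim_matrix [X in (X <= _)%N]mul1n.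
exists b; split=> // [|i];
  have := memv_pick (A :&: lker (linfun f)); rewrite -/b memv_cap => /andP[] //.
by move=> _; rewrite memv_ker fE => /eqP/rowP/(_ i); rewrite !mxE hformC.
Qed.

Lemma Gamma_dim_eq0 (k : nat) (Z Xi : S) (v : 'I_k -> V) :
  (k < \dim (ann D Z :&: ann' D Xi))%N -> Gamma D Z Xi v = 0.
Proof.
move/(perp_family v) => [b [b0 /[!memv_cap] /andP[bZ bXi] bv]].
exact: Gamma_eq0 bv.
Qed.
End Fock.

(** Xi serves as the vacuum, the vectors e_i of a basis of its annihilator as
    annihilation operators and the null dual vectors f_i as creation operators.
    The 2^p products of distinct f_i applied to Xi, p = m + 1, are linearly
    independent, hence a basis of S (+) S'. *)
Section FockBasis.
Context {C : numClosedFieldType} {m : nat} (D : spin_space C m).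
Local Notation V := (vect C m).
Local Notation S := (spinor C m).
Local Notation N := (2 ^ m + 2 ^ m)%N.
Local Notation T := 'cV[C]_N.
Local Notation hf := (hform D).
Local Notation dg := (dg D).
Local Notation beta := (beta D).

Variables (Xi : S) (E F : 'M[C]_(m.+1, m.+1 + m.+1)).
Hypothesis Xi0 : Xi != 0.
Hypothesis rowE_ann : forall i, row i E \in ann' D Xi.
Hypothesis FF : F *m ss_h D *m F^T = 0.
Hypothesis EF : E *m ss_h D *m F^T = 1%:M.

Let e i : V := row i E.
Let f i : V := row i F.
Let t0 : T := col_mx 0 Xi.

Let e_t0 i : dg (e i) *m t0 = 0.
Proof. by apply/eqP; rewrite -mem_dann -ann'_dann rowE_ann. Qed.

Let hff i j : hf (f i) (f j) = 0.
Proof. by rewrite -hform_rowE FF mxE. Qed.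

Let hef i j : hf (e i) (f j) = (i == j)%:R.
Proof. by rewrite -hform_rowE EF mxE. Qed.

Let f_anti i j : dg (f i) *m dg (f j) = - (dg (f j) *m dg (f i)).
Proof. exact: dg_anti. Qed.

Let f_sq i : dg (f i) *m dg (f i) = 0.
Proof. by rewrite dg_sq hff oppr0 raddf0. Qed.

(* The list version gl of the products g allows induction on the indices. *)
Let gl (r : seq 'I_m.+1) (P : pred 'I_m.+1) : 'M[C]_N :=
  \prod_(i <- r | P i) dg (f i).

Let g (I : {set 'I_m.+1}) : 'M[C]_N := \prod_(i <- enum I) dg (f i).

Let gl_anti j r (P : pred _) : exists b : bool,
  gl r P *m dg (f j) = (-1) ^+ b *: (dg (f j) *m gl r P).
Proof.
rewrite /gl; elim: r => [|i r [b IH]].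
  by exists false; rewrite big_nil mul1mx mulmx1 scale1r.
rewrite big_cons; case: ifP => _; last by exists b.
exists (~~ b); rewrite -[X in X *m _]/(_ *m _) -mulmxA IH -scalemxAr !mulmxA f_anti.
by rewrite mulNmx scalerN -scaleNr -mulmxA signrN opprK.
Qed.

Let f_gl j r (P : pred _) : j \in r -> P j -> dg (f j) *m gl r P = 0.
Proof.
rewrite /gl; elim: r => // i r IH; rewrite inE big_cons => jr Pj.
have [ij|ij] := eqVneq j i.
  by rewrite -ij Pj -[X in _ *m X]/(_ *m _) mulmxA f_sq mul0mx.
move: jr; rewrite (negPf ij) /= => jr; case: ifP => _; last exact: IH.
by rewrite -[X in _ *m X]/(_ *m _) mulmxA f_anti mulNmx -mulmxA IH ?mulmx0 ?oppr0.
Qed.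

Let gl_f j r (P : pred _) (M : 'M[C]_N) : j \in r -> P j -> dg (f j) *m M = 0 ->
  gl r P *m M = 0.
Proof.
move=> jr Pj jM; rewrite /gl; elim: r jr => // i r IH; rewrite inE big_cons => jr.
have [ij|ij] := eqVneq j i.
  rewrite -ij Pj -[X in X *m _]/(_ *m _) -mulmxA -/(gl r P).
  have [b /(congr1 (mulmx^~ M))] := gl_anti j r P.
rewrite -mulmxA jM mulmx0 -scalemxAl -mulmxA => /esym/eqP.
  by rewrite scaler_eq0 signr_eq0 => /eqP.
move: jr; rewrite (negPf ij) /= => jr; case: ifP => _; last exact: IH.
by rewrite -[X in X *m _]/(_ *m _) -mulmxA IH ?mulmx0.
Qed.

Let gl_compl r (P : pred _) : exists b : bool,
  gl r P *m gl r (predC P) = (-1) ^+ b *: gl r predT.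
Proof.
elim: r => [|i r [b IH]].
  by exists false; rewrite /gl !big_nil mulmx1 scale1r.
have consE Q : gl (i :: r) Q = if Q i then dg (f i) *m gl r Q else gl r Q.
  exact: big_cons.
rewrite !consE /=; case: ifP => Pi /=.
  by exists b; rewrite -mulmxA IH -scalemxAr.
have [b' iE] := gl_anti i r P; exists (b' (+) b).
by rewrite mulmxA iE -scalemxAl -mulmxA IH -scalemxAr scalerA signr_addb.
Qed.

Let gE I : g I = gl (enum 'I_m.+1) (mem I).
Proof. by rewrite /gl -big_filter enumT. Qed.

Let g_meet (I J : {set _}) : ~~ [disjoint I & J] -> g J *m g I = 0.
Proof.
move=> /pred0Pn[j /andP[jI jJ]]; rewrite !gE.
by apply: (@gl_f j) => //; rewrite ?mem_enum // f_gl ?mem_enum.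
Qed.

Let g_compl (I : {set _}) : exists b : bool, g (~: I) *m g I = (-1) ^+ b *: g [set: 'I_m.+1]%SET.
Proof.
have [b bE] := gl_compl (enum 'I_m.+1) (mem (~: I)); exists b.
rewrite !gE (_ : gl _ (mem I) = gl (enum 'I_m.+1) (predC (mem (~: I)))); last first.
  by apply: eq_bigl => i; rewrite /= inE negbK.
by rewrite bE; congr (_ *: _); apply: eq_bigl => i; rewrite /= inE.
Qed.

Let keeps_g i (I : {set _}) : i \notin I -> keeps D (e i) (g I).
Proof.
move=> iI; rewrite gE; apply: keeps_prod => j jI; apply: keeps_dg.
by rewrite hef; case: eqP iI jI => //= -> /negPf ->.
Qed.

Let e0 i : e i != 0.
Proof.
apply/eqP => ei0; have := hef i i; rewrite ei0 eqxx (hformC D 0) hform0r.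
by move/esym/eqP; rewrite oner_eq0.
Qed.

(* If i is missing, then e_i annihilates both arguments. *)
Let beta_missing i (I J : {set _}) : i \notin I -> i \notin J ->
  beta (g J *m (g I *m t0)) t0 = 0.
Proof.
move=> iI iJ; apply: (@beta_common_ann _ _ D (e i)) => //.
by apply: keeps_g => //; apply: keeps_g.
Qed.

Let gT_neq0 : g [set: 'I_m.+1]%SET *m t0 != 0.
Proof.
have gl_neq0 r : uniq r -> gl r predT *m t0 != 0.
  rewrite /gl; elim: r => [_|i r IH /= /andP[ir ur]].
    by rewrite big_nil mul1mx col_mx_eq0 negb_and Xi0 orbT.
  rewrite big_cons -/(gl r predT); apply: contraNneq (IH ur) => fy0.
  have ey0 : dg (e i) *m (gl r predT *m t0) = 0.
    rewrite /gl big_seq_cond; apply: keeps_prod => // j; rewrite andbT => jr.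
    by apply: keeps_dg; rewrite hef; case: eqP ir jr => // -> /negPf ->.
  have := congr1 (mulmx^~ (gl r predT *m t0)) (dg_clifford D (e i) (f i)).
  have fy : dg (f i) *m (gl r predT *m t0) = 0 by rewrite mulmxA.
  rewrite mulmxDl -!mulmxA ey0 mulmx0 addr0 mul_scalar_mx hef eqxx mulr1.
  by rewrite fy mulmx0 => /esym/eqP; rewrite scaler_eq0 oppr_eq0 pnatr_eq0.
have := gl_neq0 _ (enum_uniq 'I_m.+1).
by rewrite (_ : gl _ _ = g [set: 'I_m.+1]%SET) // gE; apply: eq_bigl => i; rewrite /= inE.
Qed.

(* Multiplying by the f_i, i outside I, kills all J that are not contained in I. *)
Let g_isolate (c : {set 'I_m.+1} -> C) (I : {set _}) :
  (forall I' : {set _}, I' \proper I -> c I' = 0) ->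
  exists b : bool, g (~: I) *m (\sum_J c J *: (g J *m t0))
    = ((-1) ^+ b * c I) *: (g [set: 'I_m.+1]%SET *m t0).
Proof.
move=> cI; have [b bE] := g_compl I; exists b.
rewrite mulmx_sumr (bigD1 I) //= big1 ?addr0 => [|J JI].
  by rewrite -scalemxAr mulmxA bE -scalemxAl scalerA mulrC.
rewrite -scalemxAr mulmxA; have [sJI|nJI] := boolP (J \subset I).
  by rewrite cI ?scale0r // finset.properEneq JI.
by rewrite g_meet ?mul0mx ?scaler0 // finset.disjoints_subset finset.setCK.
Qed.

Let g_free (c : {set 'I_m.+1} -> C) :
  \sum_J c J *: (g J *m t0) = 0 -> forall I, c I = 0.
Proof.
move=> c0 I; have [k] := ubnP #|I|; elim: k I => // k IH I; rewrite ltnS => Ik.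
have [|b] := @g_isolate c I.
  by move=> J /proper_card JI; apply: IH; apply: leq_trans JI Ik.
rewrite c0 mulmx0 => /esym/eqP.
by rewrite scaler_eq0 (negPf gT_neq0) orbF mulf_eq0 signr_eq0 => /eqP.
Qed.

Let g_span (s : T) : exists c : {set 'I_m.+1} -> C, s = \sum_J c J *: (g J *m t0).
Proof.
pose X := [tuple g (enum_val i) *m t0 | i < #|{set 'I_m.+1}|].
have XE (i : 'I_#|{set 'I_m.+1}|) : X`_i = g (enum_val i) *m t0.
  by rewrite -tnth_nth tnth_mktuple.
have reidx (k : 'I_#|{set 'I_m.+1}| -> C) :
    \sum_i k i *: X`_i = \sum_J k (enum_rank J) *: (g J *m t0).
  rewrite [RHS](reindex _ (onW_bij _ (enum_val_bij _))) /=.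
  by apply: eq_bigr => i _; rewrite XE enum_valK.
have freeX : free X.
  apply/freeP => k; rewrite reidx => /g_free k0 i.
  by have := k0 (enum_val i); rewrite enum_valK.
have basisX : basis_of fullv X.
  rewrite basisEfree freeX subvf /= size_tuple dimvf dim_matrix [X in (X <= _)%N]muln1.
  have -> : #|{set 'I_m.+1}| = (2 ^ m.+1)%N; last by rewrite card_ord addnn -mul2n -expnS leqnn.
  by rewrite -(finset.cardsT {set 'I_m.+1}) -finset.powersetT finset.card_powerset cardsT card_ord.
exists (fun J => coord X (enum_rank J) s).
by rewrite -(reidx (fun i => coord X i s)) -(coord_basis basisX) ?memvf.
Qed.

Let beta_top : beta (g [set: 'I_m.+1]%SET *m t0) t0 != 0.
Proof.
apply: contraTneq isT => top0 /=.
have /beta_nondeg t00 : forall s, beta s t0 = 0.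
  move=> s; have [c ->] := g_span s; rewrite beta_suml big1 // => I _.
  rewrite betaZl; have [->|] := eqVneq I [set: 'I_m.+1]%SET; first by rewrite top0 mulr0.
  rewrite -finset.subTset => /subsetPn[i _ iI].
  have := @beta_missing i I finset.set0 iI; rewrite inE /g enum_set0 big_nil mul1mx => -> //.
  by rewrite mulr0.
by have := gT_neq0; rewrite t00 mulmx0 eqxx.
Qed.

(* Chirality: 1 on S and -1 on S'. *)
Let sg : 'M[C]_N := block_mx 1%:M 0 0 (- 1%:M).

Let sg_g (I : {set _}) : sg *m (g I *m t0) = (-1) ^+ #|I|.+1 *: (g I *m t0).
Proof.
have sg_dg v : sg *m dg v = - (dg v *m sg).
  rewrite /sg /Defs.dirac_gen !mulmx_block !mulmx0 !mul0mx !mul1mx !mulmx1.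
  by rewrite !addr0 !add0r mulNmx mul1mx mulmxN mulmx1 opp_block_mx !oppr0 opprK.
have sg_gl r (P : pred 'I_m.+1) : sg *m (gl r P *m t0) = (-1) ^+ (count P r).+1 *: (gl r P *m t0).
  rewrite /gl; elim: r => [|i r IH].
    rewrite big_nil mul1mx /sg mul_block_col !mulmx0 !mul0mx addr0 add0r mulNmx mul1mx.
    by rewrite expr1 scaleN1r opp_col_mx oppr0.
  rewrite big_cons /=; case: ifP => //= _.
  rewrite -[X in X *m t0]/(_ *m _) -mulmxA mulmxA sg_dg mulNmx -mulmxA IH.
  by rewrite -scalemxAr -scaleNr add1n [in RHS]exprS mulN1r.
rewrite gE sg_gl; congr (_ ^+ _.+1 *: _).
by rewrite cardE enumT -size_filter.
Qed.

(** If Z in S pairs to zero with Xi in all degrees k < m, k = m mod 2, then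
    only the Fock states with one creation operator contribute to Z: those with
    an even number of them lie in S', and the coefficient of a set I of odd size
    at least 3 is, up to a non-zero factor, the value of the form of degree
    p - #|I| < m on the vectors f_i, i outside I, where p = m + 1. *)
Lemma Gamma_eq0_tw (Z : S) :
  (forall k : nat, (k < m)%N -> k = m %[mod 2] ->
     forall v : 'I_k -> V, Gamma D Z Xi v = 0) ->
  exists X, Z = tw D Xi X.
Proof.
move=> GZ; have [c cE] := g_span (col_mx Z 0).
have c_even (I : {set _}) : ~~ odd #|I| -> c I = 0.
  move=> evenI.
  have: \sum_J (c J * (1 + (-1) ^+ #|J|)) *: (g J *m t0) = 0.
    have: sg *m col_mx Z 0 = col_mx Z 0.
      by rewrite /sg mul_block_col !mulmx0 !mul0mx !addr0 mul1mx.
    rewrite {1 2}cE => /esym/eqP; rewrite -subr_eq0 mulmx_sumr -sumrB => /eqP cZ.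
    rewrite -[RHS]cZ; apply: eq_bigr => J _.
    by rewrite -scalemxAr sg_g scalerA -scalerBl exprS mulN1r mulrN opprK mulrDr mulr1.
  move/g_free/(_ I)/eqP; rewrite -signr_odd (negPf evenI) expr0 mulf_eq0.
  by rewrite -mulr2n pnatr_eq0 orbF => /eqP.
have c_odd (I : {set _}) : odd #|I| -> #|I| != 1%N -> c I = 0.
  move=> oddI I1; have I_gt2 : (2 < #|I|)%N by case: #|I| oddI I1 => [|[|[|]]].
  have cardI : (#|~: I| + #|I| = m.+1)%N by rewrite addnC cardsC card_ord.
  have lt_m : (#|~: I| < m)%N by lia.
  have eq_m : #|~: I| = m %[mod 2].
    rewrite !modn2; congr nat_of_bool; apply: negb_inj.
    by have := congr1 odd cardI; rewrite oddD oddI addbT.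
  have := GZ #|~: I| lt_m eq_m (fun i => f (enum_val i)).
  rewrite /Gamma skew_prod_anticomm => [|i j _]; last exact: f_anti.
  rewrite [\prod_(i < _) _](_ : _ = g (~: I)); last first.
    rewrite /g (big_nth ord0) -cardE big_mkord.
    by apply: eq_bigr => i _; rewrite -(enum_val_nth ord0).
  rewrite -[_ 0 0]/(beta _ t0).
  rewrite cE mulmx_sumr beta_suml (bigD1 I) //= big1 ?addr0 => [|J JI].
    have [b bE] := g_compl I.
    rewrite -scalemxAr mulmxA bE -scalemxAl scalerA betaZl => /eqP.
    by rewrite mulf_eq0 (negPf beta_top) orbF mulf_eq0 signr_eq0 orbF => /eqP.
  rewrite -scalemxAr betaZl; have [sJI|nJI] := boolP (J \subset I).
    have /properP[_ [i iI iJ]] : J \proper I by rewrite finset.properEneq JI.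
    by rewrite (@beta_missing i) ?mulr0 // inE negbK.
  rewrite mulmxA g_meet ?mul0mx; last first.
    by rewrite finset.disjoints_subset finset.setCK.
  by rewrite /beta trmx0 !mul0mx mxE mulr0.
pose X := \sum_(I : {set 'I_m.+1} | #|I| == 1%N) c I *: \sum_(i in I) f i.
exists X; suff: col_mx Z 0 = dg X *m t0.
  by rewrite dg_S' => /eq_col_mx[].
rewrite cE (bigID (fun I : {set 'I_m.+1} => #|I| == 1%N)) /= [X in _ + X]big1 ?addr0; last first.
  move=> I I1; have [oddI|evenI] := boolP (odd #|I|).
    by rewrite c_odd ?scale0r.
  by rewrite c_even ?scale0r.
rewrite dg_sum mulmx_suml; apply: eq_bigr => I /cards1P[i ->].
by rewrite dgZ -scalemxAl /g enum_set1 big_seq1 big_set1.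
Qed.
End FockBasis.

(** * Annihilators of pure spinors are self-dual *)

Section SelfDual.
Context {C : numClosedFieldType} {m : nat} (D : spin_space C m).
Local Notation V := (vect C m).
Local Notation S := (spinor C m).
Local Notation N := (2 ^ m + 2 ^ m)%N.
Local Notation T := 'cV[C]_N.
Local Notation hf := (hform D).
Local Notation dg := (dg D).

Lemma prod_dg_swap (k : nat) (w : 'I_k -> V) (v : V) (t : T) :
  (forall i, hf v (w i) = 0) ->
  \prod_i dg (w i) *m (dg v *m t) = (-1) ^+ k *: (dg v *m (\prod_i dg (w i) *m t)).
Proof.
elim: k w => [|k IH] w vw; first by rewrite !big_ord0 !mul1mx scale1r.
rewrite !big_ord_recl -!mulmxE -!mulmxA IH // -scalemxAr !mulmxA.
rewrite (@dg_anti _ _ D (w ord0)) ?(hformC D _ v) // !mulNmx scalerN -scaleNr.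
by rewrite exprS mulN1r.
Qed.

(** The action of the frame u, w on a spinor t with w_i t = - u_i t. *)
Lemma prod_split_sign (k : nat) (u w : 'I_k -> V) (t : T) :
  (forall i, hf (u i) (u i) = -1) -> (forall i j, hf (u i) (w j) = 0) ->
  (forall i, dg (w i) *m t = - (dg (u i) *m t)) ->
  \prod_i dg (u i) *m (\prod_i dg (w i) *m t) = (-1) ^+ 'C(k.+1, 2) *: t.
Proof.
elim: k u w => [|k IH] u w uu uw wt.
  by rewrite !big_ord0 !mul1mx scale1r.
rewrite !big_ord_recr /= -!mulmxE -!mulmxA wt mulmxN.
rewrite (@prod_dg_swap _ (fun i => w (widen_ord (leqnSn k) i))) // !mulmxN.
rewrite -!scalemxAr (mulmxA (dg (u ord_max)) (dg (u ord_max))).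
rewrite dg_sq uu opprK mul1mx IH // scalerA -scaleNr.
by rewrite [in RHS]binS bin1 exprD mulrC exprS mulN1r mulrN.
Qed.

Lemma imaginary_sign (p : nat) :
  'i ^+ odd p * 'i ^+ p = (-1) ^+ 'C(p.+1, 2) :> C.
Proof.
elim: p => [|p IH]; first by rewrite mulr1.
rewrite binS bin1 exprD -IH exprS /= -(signr_odd _ p.+1) /=.
case: (odd p); rewrite /= ?expr0 ?expr1 ?mul1r ?mulr1 //.
by rewrite mulrA -expr2 sqrCi mulrC.
Qed.

(** With E a basis of the annihilator of Z and F a null dual family, the
    frame E - F / 2, E + F / 2 is orthonormal up to signs, so that the volume
    element is a multiple of the product of its elements; the latter acts on Z
    by a sign. *)
Lemma vol_dual_basis (Z : S) (E F : 'M[C]_(m.+1, m.+1 + m.+1)) :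
  Z != 0 -> (forall i, row i E \in ann D Z) ->
  E *m ss_h D *m E^T = 0 -> F *m ss_h D *m F^T = 0 ->
  E *m ss_h D *m F^T = 1%:M ->
  ss_vol D * \det (col_mx E F) = 'i ^+ m.+1.
Proof.
move=> Z0 rowE_ann EE FF EF; pose t : T := col_mx Z 0.
have FE : F *m ss_h D *m E^T = 1%:M.
  by apply: trmx_inj; rewrite !trmx_mul !trmxK ss_h_sym mulmxA EF trmx1.
have hEE i j : hf (row i E) (row j E) = 0 by rewrite -hform_rowE EE mxE.
have hFF i j : hf (row i F) (row j F) = 0 by rewrite -hform_rowE FF mxE.
have hEF i j : hf (row i E) (row j F) = (i == j)%:R by rewrite -hform_rowE EF mxE.
have hFE i j : hf (row i F) (row j E) = (i == j)%:R by rewrite -hform_rowE FE mxE.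
pose u i := row i E - 2^-1 *: row i F; pose w i := row i E + 2^-1 *: row i F.
have uu i j : hf (u i) (u j) = - (i == j)%:R.
  rewrite /u hformBr hformZr hformC hformBr hformZr (hformC D (_ - _) (row j F)) hformBr hformZr.
  by rewrite hEE hEF hFE hFF (eq_sym j i); field.
have ww i j : hf (w i) (w j) = (i == j)%:R.
  by rewrite /w !hformDr !hformDl !hformZr !hformZl hEE hEF hFE hFF; field.
have wu i j : hf (w i) (u j) = 0.
  by rewrite /w /u hformBr hformZr !hformDl !hformZl hEE hEF hFE hFF; field.
pose Q := col_mx (E - 2^-1 *: F) (E + 2^-1 *: F).
have Qu i : row (lshift m.+1 i) Q = u i.
  by apply/rowP => j; rewrite mxE col_mxEu !mxE.
have Qw i : row (rshift m.+1 i) Q = w i.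
  by apply/rowP => j; rewrite mxE col_mxEd !mxE.
have QE : Q = block_mx 1%:M (- 2^-1)%:M 1%:M (2^-1)%:M *m col_mx E F.
  by rewrite mul_block_col !mul1mx !mul_scalar_mx scaleNr.
have detQ : \det Q = \det (col_mx E F).
  rewrite QE det_mulmx (_ : block_mx _ _ _ _ = block_mx 1%:M 0 1%:M 1%:M
      *m block_mx 1%:M (- 2^-1)%:M 0 1%:M); last first.
    rewrite mulmx_block ?(mul1mx, mulmx1, mulmx0, mul0mx, addr0).
    by congr block_mx; rewrite -raddfD; congr (_%:M); field.
  by rewrite det_mulmx det_lblock det_ublock !det1 !mulr1 mul1r.
have Q_unit : Q \in unitmx.
  have : \det (col_mx E F *m ss_h D *m (col_mx E F)^T) != 0.
    rewrite tr_col_mx mul_col_mx mul_col_row EE FF EF FE.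
    have : (block_mx 0 1%:M 1%:M 0 : 'M[C]_(m.+1 + m.+1)) \in unitmx.
      apply: (proj1 (@mulmx1_unit _ _ _ (block_mx 0 1%:M 1%:M 0) _)).
      by rewrite mulmx_block !mul1mx !mulmx0 !mul0mx !addr0 !add0r -scalar_mx_block.
    by rewrite unitmxE unitfE.
  by rewrite unitmxE unitfE detQ !det_mulmx !mulf_eq0 !negb_or => /andP[/andP[]].
pose q i := dg (row i Q).
have q_anti i j : i != j -> q i * q j = - (q j * q i).
  move=> ne; apply: dg_anti.
  have wu' a b : hf (u a) (w b) = 0 by rewrite hformC wu.
  case: (split_ordP i) ne => i' ->; case: (split_ordP j) => j' ->; rewrite ?Qu ?Qw //.
    by rewrite uu (inj_eq (@lshift_inj _ _)) => /negPf ->; rewrite oppr0.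
  by rewrite ww (inj_eq (@rshift_inj _ _)) => /negPf ->.
have qt : \prod_i q i *m t = (-1) ^+ 'C(m.+2, 2) *: t.
  have Et i : dg (row i E) *m t = 0 by apply/eqP; rewrite -mem_dann -ann_dann.
  rewrite -(@prod_split_sign _ u w) => [|i|i j|i].
  - rewrite big_split_ord mulmxA; congr (_ *m _ *m _); apply: eq_bigr => i _.
      by rewrite /q Qu.
    by rewrite /q Qw.
  - by rewrite uu eqxx.
  - by rewrite hformC wu.
  by rewrite /w /u dgD dgB dgZ mulmxDl mulmxBl Et add0r sub0r opprK.
have := ss_chirality D; rewrite (skew_prod_basis (P := invmx Q) q_anti); last first.
  move=> a; transitivity (dg (delta_mx 0 a)).
    rewrite dgE (bigD1 a) //= big1 ?addr0 => [|b ne]; rewrite mxE eqxx /=.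
      by rewrite eqxx scale1r.
    by rewrite (negPf ne) scale0r.
  rewrite -{1}[delta_mx _ _]mulmx1 -(mulVmx Q_unit) mulmxA -rowE mulmx_sum_row dg_sum.
  by apply: eq_bigr => b _; rewrite dgZ mxE.
move/(congr1 (mulmx^~ t)); rewrite -!scalemxAl qt /t mul_block_col.
rewrite !mul1mx !mulmx0 !mul0mx addr0 add0r scalerA !scale_col_mx.
move=> /eq_col_mx[/eqP + _]; rewrite -subr_eq0 -scalerBl scaler_eq0 (negPf Z0).
rewrite orbF subr_eq0 det_inv detQ -imaginary_sign => /eqP volE.
have det0 : \det (col_mx E F) != 0 by rewrite -detQ -unitfE -unitmxE.
have i0 : 'i ^+ odd m.+1 != 0 :> C by rewrite expf_neq0 // neq0Ci.
by apply: (mulfI i0); rewrite mulrA -volE mulrAC mulVf ?mul1r.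
Qed.

Lemma ann_self_dual (Z : S) : Z != 0 -> \dim (ann D Z) = m.+1 ->
  self_dual D (ann D Z).
Proof.
move=> Z0 dimZ; have [E [F [spanE EE FF EF]]] := dual_basis dimZ (ann_null Z0).
have rowE_ann i : row i E \in ann D Z.
  by apply/spanE; exists (delta_mx 0 i); rewrite rowE.
have EFvol := vol_dual_basis Z0 rowE_ann EE FF EF.
move=> e v eA.
have [c eE] : exists c : 'M[C]_(m.+1), e = c *m E.
  have /fin_all_exists[c cE] : forall i, (exists c : 'rV_m.+1, row i e = c *m E).
    by move=> i; apply/spanE/eA.
  exists (\matrix_i c i); apply/row_matrixP => i.
  by rewrite row_mul rowK cE.
pose b := v *m ss_h D *m E^T.
have vE := dual_basisE EE FF EF v.
have -> : col_mx e v = block_mx c 0 (v *m ss_h D *m F^T) b *m col_mx E F.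
  by rewrite mul_block_col mul0mx addr0 -vE -eE.
rewrite det_mulmx det_lblock mulrCA EFvol mulrC; congr (_ * _).
have -> : e *m ss_h D *m v^T = c *m b^T.
  by rewrite eE /b !trmx_mul !trmxK ss_h_sym !mulmxA.
by rewrite det_mulmx det_tr.
Qed.
End SelfDual.

(** * The twistor locus *)

Section TwistorLocus.
Context {C : numClosedFieldType} {m : nat} (D : spin_space C m).
Local Notation V := (vect C m).
Local Notation S := (spinor C m).
Local Notation hf := (hform D).

Variable Xi : S.
Hypothesis hXi : pure' D Xi.
Let B := ann' D Xi.
Local Notation tw := (tw D Xi).
Local Notation W := (twistor_locus D Xi).

Lemma dim_cap_ann' X : hf X X = 0 -> X \notin B ->
  \dim (ann D (tw X) :&: B) = m.
Proof.
move=> XX XB; have [b bB Xb] := null_not_perp hXi XB.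
have [annE _] := ann_tw hXi XX XB.
have -> : (ann D (tw X) :&: B = B :&: perp D X)%VS.
  apply/vspaceP => v; rewrite !memv_cap andbC; apply: andb_id2l => vB.
  apply/idP/idP => [vX|Xv]; last first.
    by rewrite annE; apply: (subvP (addvSr _ _)); rewrite memv_cap vB.
  rewrite mem_perp; apply/eqP; apply: ann_null vX; first by rewrite tw_eq0.
  by rewrite annE; apply: (subvP (addvSl _ _)); apply: memv_line.
by apply: succn_inj; rewrite (dim_cap_perp bB Xb); case: hXi.
Qed.

Lemma tw_in_hat X : hf X X = 0 -> X \notin B ->
  hat D <[X]>%VS <[tw X]>%VS.
Proof.
move=> XX XB; have [annE dimX] := ann_tw hXi XX XB.
have tw0 : tw X != 0 by rewrite tw_eq0.
split; last first.
  rewrite check_line // annE -memvE.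
  by apply: (subvP (addvSl _ _)); apply: memv_line.
have [c c0 cE] := vpick_line tw0.
split; first by rewrite dim_vline tw0.
by split; rewrite cE ?scaler_eq0 ?negb_or ?c0 // ann_scale.
Qed.

Lemma tw_in_locus X : hf X X = 0 -> X \notin B -> W <[tw X]>%VS.
Proof.
move=> XX XB; split=> [|k km _ v].
  exists <[X]>%VS; last exact: tw_in_hat.
  by apply/complement_line.
have tw0 : tw X != 0 by rewrite tw_eq0.
have [c c0 cE] := vpick_line tw0.
by apply: Gamma_dim_eq0; rewrite cE ann_scale // dim_cap_ann'.
Qed.

Lemma locus_tw z : W z -> exists X, [/\ z = <[tw X]>%VS, hf X X = 0 & X \notin B].
Proof.
move=> [[x _ [[dimz [Z0 _]] _]] Gz].
have [Xi0 dimB] := hXi.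
have [E [F [spanE EE FF EF]]] := dual_basis dimB (ann'_null Xi0).
have [|X ZE] := @Gamma_eq0_tw _ _ _ _ E F Xi0 _ FF EF _ Gz.
  by move=> i; apply/spanE; exists (delta_mx 0 i); rewrite rowE.
have XB : X \notin B by rewrite -(tw_eq0 D Xi) -ZE.
have [Y [YE YY YB]] := null_lift hXi XB.
by exists Y; rewrite YE -ZE -line_vpick.
Qed.

Lemma locus_line (Z : S) : Z != 0 -> W <[Z]>%VS <-> exists X, Z = tw X.
Proof.
move=> Z0; split=> [/locus_tw[X [ZX _ _]]|[X ZE]].
  have /vlineP[c ->] : Z \in <[tw X]>%VS by rewrite -ZX memv_line.
  by exists (c *: X); rewrite twZ.
have XB : X \notin B by rewrite -(tw_eq0 D Xi) -ZE.
by have [Y [YE YY YB]] := null_lift hXi XB; rewrite ZE -YE; apply: tw_in_locus.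
Qed.

(** The locus meets the fibre of a point <X> of U exactly in <tw X>. *)
Lemma locus_hat X : hf X X = 0 -> X \notin B ->
  W `&` hat D <[X]>%VS = [set <[tw X]>%VS].
Proof.
move=> XX XB; apply/seteqP; split=> z /=; last first.
  by move=> ->; split; [apply: tw_in_locus | apply: tw_in_hat].
move=> [/locus_tw[Y [-> YY YB]] [_]].
by rewrite check_line ?tw_eq0 // -memvE => XY; apply: (tw_inj hXi).
Qed.
End TwistorLocus.

(** * Differentiability of linear maps between matrix spaces *)

Lemma mx_linear_differentiable (K : numFieldType) (a b : nat)
    (W : normedModType K) (f : {linear 'M[K]_(a, b) -> W}) (M : 'M[K]_(a, b)) :
  differentiable f M.
Proof.
have -> : f = (\sum_i \sum_j (fun N : 'M[K]_(a, b) => N i j *: f (delta_mx i j))) :> (_ -> _).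
  apply/funext => N; rewrite {1}[N]matrix_sum_delta fct_sumE linear_sum.
  apply: eq_bigr => i _; rewrite fct_sumE linear_sum; apply: eq_bigr => j _.
  by rewrite linearZ.
apply: differentiable_sum => i; apply: differentiable_sum => j.
by apply: differentiableZl; apply: differentiable_coord.
Qed.

Lemma mx_linear_diff (K : numFieldType) (a b : nat) (W : normedModType K)
    (f : 'M[K]_(a, b) -> W) (M : 'M[K]_(a, b)) : linear f ->
  differentiable f M /\ 'd f M = f :> (_ -> _).
Proof.
move=> f_lin.
pose Hf := GRing.isLinear.Build _ _ _ _ f f_lin.
pose F : {linear 'M[K]_(a, b) -> W} := HB.pack f Hf.
have F_cont : continuous F.
  by move=> N; apply: differentiable_continuous; apply: mx_linear_differentiable.
by split; [exact: (mx_linear_differentiable F) | exact: (diff_lin M F_cont)].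
Qed.

Lemma mx_affine_diff (K : numFieldType) (a b : nat) (W : normedModType K)
    (f : 'M[K]_(a, b) -> W) (w : W) (M : 'M[K]_(a, b)) : linear f ->
  differentiable (fun N => w + f N) M
  /\ 'd (fun N => w + f N) M = f :> (_ -> _).
Proof.
move=> /(mx_linear_diff M)[df dfE].
split; first exact: differentiableD (differentiable_cst _ _) df.
rewrite (diffD (differentiable_cst _ _) df) diff_cst dfE.
by apply/funext => N; rewrite /= add0r.
Qed.

Section LocusSubmanifold.
Context {C : numClosedFieldType} {m : nat} (D : spin_space C m).
Local Notation V := (vect C m).
Local Notation S := (spinor C m).

(** The cone over the locus is a linear subspace, hence the zero set of a
    surjective linear map. *)
Lemma locus_submanifold (Xi : S) : pure' D Xi -> submanifold (twistor_locus D Xi).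
Proof.
move=> hXi; pose f X := (tw D Xi X)^T.
have f_lin : linear f.
  by move=> a X Y; rewrite /f (tw_linear D Xi) [LHS]linearP.
pose Hf := GRing.isLinear.Build _ _ _ _ f f_lin.
pose A := lin1_mx (HB.pack f Hf : {linear _ -> _}).
have AE X : X *m A = (tw D Xi X)^T by rewrite mul_rV_lin1.
pose K := col_base (cokermx A).
exists (\rank (cokermx A)) => Z0 Z0_neq0 _; exists (fun Z => Z^T *m K).
have F_lin : linear (fun Z : S => Z^T *m K).
  by move=> a Z Z'; rewrite [(_ + _)^T]linearP mulmxDl -scalemxAl.
near=> Z.
have Z_neq0 : Z != 0 by near: Z; apply: (cvgr_neq0 (f := id) _ _ Z0_neq0); exact: cvg_id.
have [dF dFE] := mx_linear_diff Z F_lin; split=> //.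
  rewrite dFE.
  suff -> : limg (linfun (fun Z : S => Z^T *m K)) = fullv by rewrite dimvf dim_matrix [LHS]mul1n.
  apply/vspaceP => y; rewrite memvf; apply/memv_imgP.
  have /submxP[u uE] : (y <= K)%MS by apply: submx_full; apply: col_base_full.
  by exists u^T; rewrite ?memvf // linfunE // trmxK.
rewrite (locus_line hXi Z_neq0).
have -> : (Z^T *m K = 0) <-> (Z^T <= A)%MS.
  have -> : (Z^T <= A)%MS = (Z^T *m K *m row_base (cokermx A) == 0).
    by rewrite submxE -mulmxA mulmx_base.
  split=> [->|/eqP ZK]; first by rewrite mul0mx.
  by apply: (row_free_inj (row_base_free (cokermx A))); rewrite mul0mx.
split=> [[X ->]|/submxP[X ZX]]; first by rewrite -AE submxMl.
by exists X; apply: trmx_inj; rewrite -AE.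
Unshelve. all: end_near. Qed.
End LocusSubmanifold.

(** * The conformal Killing equation *)

Section ConformalKilling.
Context {C : numClosedFieldType} {m : nat} (D : spin_space C m).
Local Notation V := (vect C m).
Local Notation S := (spinor C m).
Local Notation hf := (hform D).

Lemma cl'_cl_null (X : V) (Z : S) : hf X X = 0 -> cl' D X *m (cl D X *m Z) = 0.
Proof.
move=> XX; have := congr1 (mulmx^~ (col_mx Z 0)) (dg_sq D X).
rewrite -mulmxA dg_S dg_S' XX oppr0 raddf0 mul0mx => /eqP.
by rewrite col_mx_eq0 => /andP[/eqP].
Qed.

(** In the chart with origin O and point at infinity Y the projection of Xi to
    ker Y along ker X is - Y X Xi / 2, which is affine in the coordinates. *)
Lemma component_conformal_killing (Xi : S) :
  conformal_killing D (component Xi).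
Proof.
move=> O Y e [OO YY OY _ eOY].
have xe0 x : hf O (x *m e) = 0 /\ hf Y (x *m e) = 0.
  split; rewrite mulmx_sum_row hform_sumr big1 // => a _; rewrite hformZr.
    by rewrite (eOY a).1 mulr0.
  by rewrite (eOY a).2 mulr0.
pose w := - 2^-1 *: (cl D Y *m tw D Xi O).
pose F (x : 'rV[C]_(m + m)) := - 2^-1 *: (cl D Y *m tw D Xi (x *m e)).
have F_lin : linear F.
  move=> a x y; rewrite /F mulmxDl -scalemxAl (tw_linear D Xi) mulmxDr -scalemxAr.
  by rewrite scalerDr !scalerA (mulrC a).
exists (fun x => w + F x), (fun=> - (sqrtC 2 / 2) *: tw D Xi Y) => x X.
have [dF dFE] := mx_affine_diff w x F_lin.
have XE : X = O + x *m e - (2^-1 * hf (x *m e) (x *m e)) *: Y by [].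
have YX : hf Y X = 1.
  by rewrite XE hformBr hformDr hformZr YY (xe0 x).2 hformC OY mulr0 subr0 addr0.
have XX : hf X X = 0.
  rewrite {2}XE hformBr hformDr hformZr (hformC D X Y) YX XE.
  rewrite !(hformC D (_ - _)) !hformBr !hformDr !hformZr OO OY (hformC D _ O).
  by rewrite (xe0 x).1 (hformC D _ Y) (xe0 x).2; field.
have clYY : cl D Y *m tw D Xi Y = 0 by apply: cl_tw_null.
have fE : w + F x = Xi + 2^-1 *: (cl D X *m tw D Xi Y).
  have : cl D Y *m tw D Xi X = cl D Y *m tw D Xi O + cl D Y *m tw D Xi (x *m e).
    rewrite XE -scaleNr addrC (tw_linear D Xi) mulmxDr -scalemxAr clYY scaler0 add0r.
    by rewrite (twD D Xi) mulmxDr.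
  rewrite /w /F -scalerDr => <-; rewrite cl_tw YX mulr1 scalerBr scalerA.
  rewrite mulrN mulNr opprK mulVf ?pnatr_eq0 // scale1r.
  by rewrite scaleNr opprK.
split=> //.
- rewrite -scalerDr -mulmxDr -scalemxAr cl'_cl_null ?scaler0 //.
- by rewrite -scalemxAr clYY scaler0.
- by rewrite fE /component addrC addKr -scalemxAr cl'_cl_null ?scaler0.
move=> a; rewrite deriveE // dFE /F -rowE cl_tw (eOY a).2 mulr0 oppr0 scale0r sub0r.
rewrite scalerN scaleNr opprK -scalemxAr scalerA mulrN mulrA mulVf ?mul1r.
  by rewrite scaleNr subrr.
by rewrite sqrtC_eq0 pnatr_eq0.
Qed.

Lemma component_pure_field (Xi : S) : pure' D Xi ->
  pure_field D (component Xi).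
Proof.
move=> hXi x [/line_vpick xE nullx] xi0; rewrite /nonvanishing_at /component in xi0.
have XX : hf (vpick x) (vpick x) = 0 by apply: nullx; apply: memv_pick.
have XB : vpick x \notin ann' D Xi by rewrite -(tw_eq0 D Xi).
by rewrite xE annihilator_line // (ann_tw hXi XX XB).2.
Qed.
End ConformalKilling.

(** * The null structure and its integral manifolds *)

Section NullStructure.
Context {C : numClosedFieldType} {m : nat} (D : spin_space C m).
Local Notation V := (vect C m).
Local Notation S := (spinor C m).
Local Notation hf := (hform D).

Variable Xi : S.
Hypothesis hXi : pure' D Xi.
Let B := ann' D Xi.
Local Notation tw := (tw D Xi).
Local Notation W := (twistor_locus D Xi).
Local Notation U := (complement_of D Xi).
Local Notation N := (annihilator D (component Xi)).

Let nullB : totally_null D B. Proof. by case: hXi => Xi0 _; apply: ann'_null. Qed.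

Lemma distribution_line X : hf X X = 0 -> X \notin B ->
  N <[X]>%VS = (<[X]> + (B :&: perp D X))%VS.
Proof. by move=> XX XB; rewrite annihilator_line // (ann_tw hXi XX XB).1. Qed.

Lemma distribution_null x : U x ->
  [/\ \dim (N x) = m.+1, (x <= N x)%VS & totally_null D (N x)].
Proof.
move=> /complement_lineP[X [-> XX XB]]; rewrite annihilator_line //.
have [annE dimX] := ann_tw hXi XX XB.
split=> //; first by rewrite annE addvSl.
by apply: ann_null; rewrite tw_eq0.
Qed.

Lemma hform_near_neq0 (b X0 : V) : hf X0 b != 0 -> \forall X \near X0, hf X b != 0.
Proof.
move=> X0b; have f_lin : linear (fun X => hf X b : C^o).
  by move=> a X Y; rewrite hformDl hformZl.
have [df _] := mx_linear_diff X0 f_lin.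
exact: cvgr_neq0 (differentiable_continuous df) X0b.
Qed.

(** With b0 in B not orthogonal to X0, and e a basis of the part of B
    orthogonal to X0, the vectors X and h(b0, X) e_j - h(e_j, X) b0 span the
    distribution for all X not orthogonal to b0. *)
Lemma distribution_holomorphic : holomorphic_distribution N U.
Proof.
move=> X0 _ /complement_line[X00 X0B].
have [b0 b0B X0b0] := null_not_perp hXi X0B.
have dimH : \dim (B :&: perp D X0) = m.
  by apply: succn_inj; rewrite (dim_cap_perp b0B X0b0); case: hXi.
have [e _ spanH] := vspace_rowbasis dimH.
have eB j : row j e \in B.
  have : row j e \in (B :&: perp D X0)%VS.
    by apply/spanH; exists (delta_mx 0 j); rewrite rowE.
  by rewrite memv_cap => /andP[].
pose t j (X : V) := hf X b0 *: row j e - hf X (row j e) *: b0.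
pose s (i : 'I_m.+1) := if unlift ord0 i is Some j then t j else id.
have s0 X : s ord0 X = X by rewrite /s unlift_none.
have sl j X : s (lift ord0 j) X = t j X by rewrite /s liftK.
have s_lin i : linear (s i).
  case: (unliftP ord0 i) => [j|] -> a X Y; rewrite ?s0 // !sl /t.
  rewrite !hformDl !hformZl !scalerDl scalerBr !scalerA opprD addrACA.
  by [].
exists s; near=> X; split=> [i|/complement_line[XX XB]].
  by have [] := mx_linear_diff X (s_lin i).
have Xb0 : hf X b0 != 0 by near: X; exact: hform_near_neq0.
have tB j X' : t j X' \in B by rewrite memvB ?memvZ.
rewrite distribution_line //; apply/eqP; rewrite eqEsubv; apply/andP; split.
  have Xin : (<[X]> <= \sum_i <[s i X]>)%VS.
    by rewrite (sumv_sup ord0) // s0.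
  rewrite subv_add Xin; apply/subvP => v; rewrite memv_cap mem_perp => /andP[vB /eqP Xv].
  pose k := hf X0 v / hf X0 b0.
  have /spanH[c cE] : v - k *: b0 \in (B :&: perp D X0)%VS.
    rewrite memv_cap memvB ?memvZ //= mem_perp hformBr hformZr.
    by rewrite /k mulfVK // subrr.
  have vE : v = k *: b0 + \sum_j c 0 j *: row j e.
    by rewrite -mulmx_sum_row -cE addrC subrK.
  have eX : \sum_j c 0 j * hf X (row j e) = - (k * hf X b0).
    apply/eqP; rewrite -addr_eq0 addrC; move: Xv; rewrite {1}vE hformDr hformZr.
    rewrite hform_sumr => /eqP; congr (_ + _ == _); apply: eq_bigr => j _.
    by rewrite hformZr.
  have -> : v = (hf X b0)^-1 *: \sum_j c 0 j *: t j X.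
    have -> : \sum_j c 0 j *: t j X = hf X b0 *: v; last by rewrite scalerA mulVf ?scale1r.
    rewrite [in RHS]vE scalerDr scaler_sumr.
    under eq_bigr => j _ do rewrite /t scalerBr !scalerA.
    rewrite sumrB -scaler_suml eX scaleNr opprK scalerA addrC; congr (_ + _).
      by rewrite mulrC.
    by apply: eq_bigr => j _; rewrite scalerA mulrC.
  apply: memvZ; apply: memv_suml => j _; apply: memvZ.
  by rewrite memvE (sumv_sup (lift ord0 j)) // sl subvv.
apply/subv_sumP => i _; rewrite -memvE; case: (unliftP ord0 i) => [j|] ->.
  rewrite sl; apply: (subvP (addvSr _ _)); rewrite memv_cap tB mem_perp.
  by rewrite hformBr !hformZr mulrC subrr eqxx.
by rewrite s0; apply: (subvP (addvSl _ _)); apply: memv_line.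
Unshelve. all: end_near. Qed.

(** A point X of U lies on the affine patches X + p b, where the rows of b form
    a basis of the part of B that is orthogonal to X. *)
Lemma affine_patch X (b : 'M[C]_(m, m.+1 + m.+1)) (r : C) :
  hf X X = 0 -> X \notin B -> 0 < r ->
  (forall v, v \in (B :&: perp D X)%VS <-> exists u, v = u *m b) ->
  let P := [set <[X + p *m b]>%VS | p in ball (0 : 'rV[C]_m) r] in
  integral_patch N U P /\ forall x, P x -> U x /\ N x = N <[X]>%VS.
Proof.
move=> XX XB r0 spanH P.
have pbH p : p *m b \in (B :&: perp D X)%VS by apply/spanH; exists p.
have pbB p : p *m b \in B by have := pbH p; rewrite memv_cap => /andP[].
have Xpb p : hf X (p *m b) = 0.
  by have := pbH p; rewrite memv_cap => /andP[_]; rewrite mem_perp => /eqP.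
have phi_null p : hf (X + p *m b) (X + p *m b) = 0.
  by rewrite hformDr !hformDl XX Xpb (hformC D _ X) Xpb nullB // !addr0.
have phiB p : X + p *m b \notin B.
  by apply: contra XB => phiB; rewrite -[X](addrK (p *m b)) memvB.
have phiU p : U <[X + p *m b]>%VS by apply/complement_line.
have phiN p : N <[X + p *m b]>%VS = N <[X]>%VS.
  by rewrite !annihilator_line // (twDr _ (pbB p)).
split; last by move=> _ [p _ <-]; split.
have b_lin : linear (fun p : 'rV[C]_m => p *m b).
  by move=> a p q; rewrite mulmxDl -scalemxAl.
exists r, (fun p => X + p *m b); split=> [//|p _|]; last by [].
have [df dfE] := mx_affine_diff X p b_lin; split=> //.
  by apply: contraNneq (phiB p) => ->; rewrite mem0v.
rewrite phiN distribution_line // dfE.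
have -> : limg (linfun (fun p : 'rV[C]_m => p *m b)) = (B :&: perp D X)%VS.
  apply/vspaceP => v; apply/idP/idP => [/memv_imgP[u _ ->]|/spanH[u ->]].
    by rewrite linfunE.
  by apply/memv_imgP; exists u; rewrite ?memvf ?linfunE.
set H := (B :&: _)%VS; apply/eqP; rewrite eqEsubv !subv_add !addvSr -!memvE !andbT.
apply/andP; split.
  by apply: memv_add; rewrite ?memv_line.
rewrite -{1}[X](addrK (p *m b)).
by apply: memv_add; rewrite ?memv_line ?rpredN.
Qed.

Lemma distribution_integrable : integrable_distribution N U.
Proof.
move=> _ /complement_lineP[X [-> XX XB]].
have [b bB Xb] := null_not_perp hXi XB.
have dimH : \dim (B :&: perp D X) = m.
  by apply: succn_inj; rewrite (dim_cap_perp bB Xb); case: hXi.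
have [e _ spanH] := vspace_rowbasis dimH.
have [patch _] := affine_patch XX XB ltr01 spanH.
exists [set <[X + p *m e]>%VS | p in ball (0 : 'rV[C]_m) 1]; split=> //.
exists 0; first exact: ballxx.
by rewrite mul0mx addr0.
Qed.

Lemma distribution_null_structure : null_structure D N U.
Proof.
split; [exact: distribution_null | exact: distribution_holomorphic |].
exact: distribution_integrable.
Qed.

(** * Leaves *)

(** The part in U of the linear subspace of the quadric defined by z. *)
Definition plane_part (z : {vspace S}) : set {vspace V} :=
  [set x | U x /\ (x <= check D z)%VS].

Lemma plane_part_distribution z x : W z -> plane_part z x -> N x = check D z.
Proof.
move=> /(locus_tw hXi)[X [-> XX XB]] [/complement_lineP[Y [-> YY YB]]].
have tw0 : tw X != 0 by rewrite tw_eq0.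
rewrite check_line // -memvE annihilator_line // => YX.
have twXY := tw_inj hXi YY YB XB YX.
by rewrite -!check_line ?tw_eq0 ?twXY // -twXY check_line.
Qed.

(** Any two points of an alpha-plane of the locus lie in a common patch. *)
Lemma plane_part_patch z x y : W z -> plane_part z x -> plane_part z y ->
  exists P, [/\ integral_patch N U P, P `<=` plane_part z, P x & P y].
Proof.
move=> Wz Lx Ly; have Nx := plane_part_distribution Wz Lx.
have [Ux _] := Lx; have [Uy yz] := Ly.
have [X [xE XX XB]] := complement_lineP Ux.
have [Y [yE YY YB]] := complement_lineP Uy.
have [b bB Xb] := null_not_perp hXi XB.
have dimH : \dim (B :&: perp D X) = m.
  by apply: succn_inj; rewrite (dim_cap_perp bB Xb); case: hXi.
have [e _ spanH] := vspace_rowbasis dimH.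
have : Y \in N <[X]>%VS by rewrite -xE Nx memvE -yE.
rewrite distribution_line // => /memv_addP[_ /vlineP[a ->] [v vH YE]].
have a0 : a != 0.
  apply: contraNneq YB => a0; rewrite YE a0 scale0r add0r.
  by move: vH; rewrite memv_cap => /andP[].
have /spanH[p pE] : a^-1 *: v \in (B :&: perp D X)%VS by apply: memvZ.
(* The second point has coordinates p, so any radius above |p| will do. *)
have r0 : 0 < `|p| + 1 :> C by rewrite ltr_wpDl.
have [patch PN] := affine_patch XX XB r0 spanH.
exists [set <[X + q *m e]>%VS | q in ball (0 : 'rV[C]_m) (`|p| + 1)]; split=> //.
- move=> w /PN[Uw Nw]; split=> //.
  by rewrite -Nx xE -Nw; case: (distribution_null Uw).
- exists 0; first exact: ballxx.
  by rewrite mul0mx addr0.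
exists p; first by rewrite -ball_normE /ball_ /= sub0r normrN ltrDl.
by rewrite -pE yE YE -(vline_scale (X + _) a0) scalerDr scalerA mulfV ?scale1r.
Qed.

Lemma plane_part_integral z : W z -> integral_manifold N U (plane_part z).
Proof.
move=> Wz x Lx; have [P [iP PL Px _]] := plane_part_patch Wz Lx Lx.
by exists P.
Qed.

Lemma plane_part_connected z : W z -> int_connected N U (plane_part z).
Proof.
move=> Wz x y Lx Ly; have [P [iP PL Px Py]] := plane_part_patch Wz Lx Ly.
by apply: Relation_Operators.rt_step; exists P.
Qed.

Lemma plane_part_neq0 z : W z -> plane_part z !=set0.
Proof. by move=> [[x Ux [_ xz]] _]; exists x. Qed.

(** Nowhere vanishing maps whose derivatives are multiples of their values are
    projectively constant on balls. *)
Hypothesis proj_const : forall (n : nat) (r : C) (f : 'rV[C]_m -> 'cV[C]_n),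
  (forall p, ball (0 : 'rV[C]_m) r p ->
     [/\ differentiable f p, f p != 0
       & forall u, exists l, 'd f p u = l *: f p]) ->
  forall p, ball (0 : 'rV[C]_m) r p -> <[f p]>%VS = <[f 0%R]>%VS.

(** Along an integral patch phi the spinor tw (phi p) is projectively constant:
    its derivatives are tw (l phi p + b) with b in B. *)
Lemma patch_distribution P x y : integral_patch N U P -> P x -> P y -> N x = N y.
Proof.
move=> [r [phi [r0 phiP ->]]].
have tw_phi p : ball (0 : 'rV[C]_m) r p ->
    [/\ differentiable (tw \o phi) p, (tw \o phi) p != 0
      & forall u, exists l, 'd (tw \o phi) p u = l *: (tw \o phi) p].
  move=> rp; have [dphi phi0 /complement_line[XX XB] imphi] := phiP p rp.
  have [dtw dtwE] := mx_linear_diff (phi p) (tw_linear D Xi).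
  split=> [||u]; first exact: differentiable_comp.
    by rewrite /= tw_eq0.
  rewrite diff_comp //= dtwE.
  have : 'd phi p u \in N <[phi p]>%VS.
    rewrite -imphi; apply: (subvP (addvSr _ _)); apply/memv_imgP; exists u; rewrite ?memvf //.
    by rewrite linfunE //; apply: linearP.
  rewrite distribution_line // => /memv_addP[_ /vlineP[l ->] [v vH ->]].
  exists l; rewrite twDr ?twZ //.
  by move: vH; rewrite memv_cap => /andP[].
have NE p : ball (0 : 'rV[C]_m) r p -> N <[phi p]>%VS = check D <[tw (phi p)]>%VS.
  move=> rp; have [_ _ /complement_line[XX XB] _] := phiP p rp.
  by rewrite annihilator_line // check_line // tw_eq0.
move=> [p rp <-] [q rq <-]; rewrite !NE //.
by rewrite (proj_const tw_phi rp) (proj_const tw_phi rq).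
Qed.

Lemma integral_manifold_sub L x : integral_manifold N U L -> L x -> U x.
Proof.
move=> iL /iL[P [[r [phi [_ phiP ->]]] [p rp <-] _]].
by have [] := phiP p rp.
Qed.

Lemma connected_distribution L x y : int_connected N U L -> L x -> L y -> N x = N y.
Proof.
move=> cL Lx Ly; elim: (cL x y Lx Ly) => [a b [P [iP _ Pa Pb]]|//|a b c _ ab _ bc].
  exact: patch_distribution Pa Pb.
by rewrite ab.
Qed.

Lemma connected_sub_plane L z x : W z -> integral_manifold N U L ->
  int_connected N U L -> L x -> plane_part z x -> L `<=` plane_part z.
Proof.
move=> Wz iL cL Lx xz y Ly; have Uy := integral_manifold_sub iL Ly; split=> //.
rewrite -(plane_part_distribution Wz xz) (connected_distribution cL Lx Ly).
by case: (distribution_null Uy).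
Qed.

Lemma locus_through x : U x -> exists z,
  [/\ W `&` hat D x = [set z], N x = check D z, W z & plane_part z x].
Proof.
move=> Ux; have [X [xE XX XB]] := complement_lineP Ux.
exists <[tw X]>%VS; rewrite xE locus_hat // annihilator_line // check_line ?tw_eq0 //.
split=> //; first exact: tw_in_locus.
by split; [rewrite -xE | case: (tw_in_hat hXi XX XB)].
Qed.

Lemma leafP L : leaf N U L <-> exists z, W z /\ L = plane_part z.
Proof.
split=> [[[x Lx] iL cL maxL]|[z [Wz ->]]].
  have [z [_ _ Wz xz]] := locus_through (integral_manifold_sub iL Lx).
  exists z; split=> //; apply/esym/maxL; first exact: plane_part_integral.
    exact: plane_part_connected.
  exact: connected_sub_plane Lx xz.
split; [exact: plane_part_neq0 | exact: plane_part_integral | exact: plane_part_connected|].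
move=> L' iL' cL' sub; apply/seteqP; split=> //.
have [x xz] := plane_part_neq0 Wz.
exact: connected_sub_plane (sub _ xz) xz.
Qed.

Lemma distribution_arises : arises_from D N U W.
Proof.
split=> [x /locus_through[z [Wx Nx _ _]]|L]; first by exists z.
exact: leafP.
Qed.

Lemma leaf_plane L : leaf N U L -> exists A : {vspace V},
  [/\ alpha_plane D A, L = [set x | U x /\ (x <= A)%VS]
    & \dim (A :&: B)%VS = m].
Proof.
move=> /leafP[z [/(locus_tw hXi)[X [zE XX XB]] ->]].
have tw0 : tw X != 0 by rewrite tw_eq0.
have [_ dimX] := ann_tw hXi XX XB.
exists (ann D (tw X)); split.
- by split; [| exact: ann_null | exact: ann_self_dual].
- by rewrite /plane_part zE check_line.
exact: dim_cap_ann'.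
Qed.
End NullStructure.

(** * Projectively constant maps *)

(** A presentation of the closed field C as R[i], by real and imaginary parts. *)
Record complexification (R : realType) (C : numClosedFieldType)
    (toC : {rmorphism R -> C}) (re im : C -> R) : Prop := Complexification {
  cx_decomp : forall z, z = toC (re z) + 'i * toC (im z);
  cx_re : forall a b, re (toC a + 'i * toC b) = a;
  cx_im : forall a b, im (toC a + 'i * toC b) = b;
  cx_norm_re : forall z, toC `|re z| <= `|z|;
  cx_norm_im : forall z, toC `|im z| <= `|z|;
  cx_norm : forall a, `|toC a| = toC `|a|;
  cx_lt : forall a b, (toC a < toC b) = (a < b);
  cx_pos : forall d, 0 < d -> exists2 e, 0 < e & toC e = d }.

Section ProjectivelyConstant.
Variables (R : realType) (C : numClosedFieldType) (toC : {rmorphism R -> C}).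
Variables (re im : C -> R).
Hypothesis cx : complexification toC re im.

Let cx_eq a b z : z = toC a + 'i * toC b -> re z = a /\ im z = b.
Proof. by move=> ->; rewrite (cx_re cx) (cx_im cx). Qed.

Let cxB z w : re (z - w) = re z - re w /\ im (z - w) = im z - im w.
Proof.
apply: cx_eq; rewrite {1}(cx_decomp cx z) {1}(cx_decomp cx w) !rmorphB /=; ring.
Qed.

Let cxM z w : re (z * w) = re z * re w - im z * im w
  /\ im (z * w) = re z * im w + im z * re w.
Proof.
apply: cx_eq; rewrite {1}(cx_decomp cx z) {1}(cx_decomp cx w).
rewrite rmorphB rmorphD /= !rmorphM /=.
have ii : 'i * 'i = -1 :> C by rewrite -expr2 sqrCi.
transitivity (toC (re z) * toC (re w) + ('i * 'i) * (toC (im z) * toC (im w))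
  + 'i * (toC (re z) * toC (im w) + toC (im z) * toC (re w))); first ring.
by rewrite ii; ring.
Qed.

Let re_toC a : re (toC a) = a.
Proof. by rewrite -[in RHS](cx_re cx a 0) rmorph0 mulr0 addr0. Qed.

Let im_toC a : im (toC a) = 0.
Proof. by rewrite -[in RHS](cx_im cx a 0) rmorph0 mulr0 addr0. Qed.

(** The restriction to a real line of a real-linear coordinate of a
    complex differentiable function. *)
Lemma real_path_derive (l : C -> R) (m : nat) (F : 'rV[C]_m -> C^o)
    (p : 'rV[C]_m) (t : R) :
  (forall z w, l (z - w) = l z - l w) -> (forall (a : R) z, l (toC a * z) = a * l z) ->
  (forall z, toC `|l z| <= `|z|) -> differentiable F (toC t *: p) ->
  is_derive t 1 (fun s : R => l (F (toC s *: p))) (l ('d F (toC t *: p) p)).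
Proof.
move=> lB lZ l_le dF; set x := toC t *: p in dF *.
have dFp : derivable F x p by exact: diff_derivable dF.
rewrite -(@deriveE _ _ _ F x p dF).
have cvgF : (fun h : C => h^-1 *: (F (h *: p + x) - F x)) @ 0^' --> 'D_p F x by exact: dFp.
suff cvgl : (fun h : R => h^-1 *: (l (F (toC (h *: 1 + t) *: p)) - l (F (toC t *: p)))) @ 0^'
    --> l ('D_p F x).
  by apply: DeriveDef; [apply/cvg_ex; exists (l ('D_p F x)) | apply: cvg_lim cvgl].
apply/cvgrPdist_lt => eps eps0.
have eps0C : 0 < toC eps by rewrite -(rmorph0 toC) (cx_lt cx).
have /cvgrPdist_lt/(_ _ eps0C)[d /= d0 dP] := cvgF.
have [e e0 eE] := cx_pos cx d0.
exists e => //= h he h0.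
have hd : ball (0 : C) d (toC h).
  move: he; rewrite /ball /= !sub0r !normrN -eE (cx_norm cx) (cx_lt cx).
  by [].
have h0C : toC h != 0 by rewrite fmorph_eq0.
have := dP _ hd h0C.
rewrite -(cx_lt cx); apply: le_lt_trans; apply: le_trans (l_le _).
rewrite lB -fmorphV /= -[_ *: _]/(_ * _) lZ lB.
rewrite rmorphD /= -[h *: 1]/(h * 1) mulr1 scalerDl.
by [].
Qed.

Lemma ratio_constant (q N : R -> R) :
  (forall t : R, t \in `[0, 1]%R -> N t != 0
     /\ exists k, is_derive t 1 q (k * q t) /\ is_derive t 1 N (k * N t)) ->
  q 1 * N 0 = q 0 * N 1.
Proof.
move=> qN; pose h : R -> R := q * (fun t => (N t)^-1).
have dh (t : R) : t \in `[0, 1]%R -> is_derive t 1 h 0.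
  move=> /qN[Nt [k [dq dN]]].
  have dNV : is_derive t 1 (fun t => (N t)^-1) (- (N t) ^- 2 *: (k * N t)).
    apply: DeriveDef; first by apply: derivableV.
    by rewrite deriveV // derive_val.
  apply: is_derive_eq.
  rewrite -![_ *: _]/(_ * _); field.
  by rewrite Nt.
have dh_oo (t : R) : t \in `]0, 1[%R -> is_derive t 1 h ((fun=> 0) t).
  rewrite in_itv => /andP[/ltW t0 /ltW t1]; apply: dh.
  by rewrite in_itv /= t0 t1.
have h_cont : {within `[0, 1], continuous h}.
  by apply: derivable_within_continuous => t /dh dht; apply: ex_derive.
have [c _] := MVT_segment (ler01 : 0 <= 1 :> R) dh_oo h_cont.
rewrite mul0r => /eqP; rewrite subr_eq0 => /eqP.
have [N0 _] := qN 0 ltac:(by rewrite in_itv /= lexx ler01).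
have [N1 _] := qN 1 ltac:(by rewrite in_itv /= lexx ler01).
by move=> h10; apply/eqP; rewrite -(eqr_div _ _ N1 N0); apply/eqP.
Qed.

(** A nowhere vanishing f whose derivatives are multiples of f: along a ray the
    entries of f f^* / |f|^2, the projection onto the line of f, have zero
    derivative. *)
Lemma proj_constant (m n : nat) (r : C) (f : 'rV[C]_m -> 'cV[C]_n) :
  (forall p, ball (0 : 'rV[C]_m) r p ->
     [/\ differentiable f p, f p != 0
       & forall u, exists l, 'd f p u = l *: f p]) ->
  forall p, ball (0 : 'rV[C]_m) r p -> <[f p]>%VS = <[f 0%R]>%VS.
Proof.
move=> f_ball p rp.
have tball (t : R) : t \in `[0, 1]%R -> ball (0 : 'rV[C]_m) r (toC t *: p).
  rewrite in_itv /= => /andP[t0 t1]; move: rp; rewrite -!ball_normE /ball_ /= !sub0r !normrN.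
  apply: le_lt_trans; rewrite normrZ (cx_norm cx) ger0_norm // ler_piMl //.
  by rewrite -(rmorph1 toC) le_eqVlt (cx_lt cx) (inj_eq (fmorph_inj toC)) -le_eqVlt.
pose F k x : C^o := f x k 0.
pose a k : R -> R := fun t => re (F k (toC t *: p)).
pose b k : R -> R := fun t => im (F k (toC t *: p)).
have dab (t : R) : t \in `[0, 1]%R -> exists u v, forall k,
    is_derive t 1 (a k) (u * a k t - v * b k t)
    /\ is_derive t 1 (b k) (u * b k t + v * a k t).
  move=> /tball/f_ball[df _ /(_ p)[l dfl]]; exists (re l), (im l) => k.
  have coord_lin : linear (fun M : 'cV[C]_n => M k 0 : C^o) by move=> c M M'; rewrite !mxE.
  have [dc dcE] := mx_linear_diff (f (toC t *: p)) coord_lin.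
  have dF : differentiable (F k) (toC t *: p) by apply: (differentiable_comp df dc).
  have dFE : 'd (F k) (toC t *: p) p = l * F k (toC t *: p).
    by rewrite (diff_comp df dc) /= dcE dfl mxE.
  split.
    have := real_path_derive (l := re) _ _ (cx_norm_re cx) dF.
    rewrite dFE (cxM _ _).1; apply=> [z w|c z]; first by rewrite (cxB _ _).1.
    by rewrite (cxM _ _).1 re_toC im_toC mul0r subr0.
  have := real_path_derive (l := im) _ _ (cx_norm_im cx) dF.
  rewrite dFE (cxM _ _).2; apply=> [z w|c z]; first by rewrite (cxB _ _).2.
  by rewrite (cxM _ _).2 re_toC im_toC mul0r addr0.
pose N : R -> R := \sum_k (a k * a k + b k * b k).
have NE t : N t = \sum_k (a k t ^+ 2 + b k t ^+ 2).
  by rewrite /N fct_sumE; apply: eq_bigr.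
have N_neq0 (t : R) : t \in `[0, 1]%R -> N t != 0.
  move=> /tball/f_ball[_ + _]; apply: contraNneq; rewrite NE => /eqP.
  rewrite psumr_eq0 => [/allP N0|k _]; last by rewrite addr_ge0 ?sqr_ge0.
  apply/eqP/colP => k; have := N0 k (mem_index_enum _).
  rewrite paddr_eq0 ?sqr_ge0 // !sqrf_eq0 => /andP[/eqP ak /eqP bk].
  rewrite -[LHS]/(F k (toC t *: p)) (cx_decomp cx (F k _)) -/(a k t) -/(b k t) ak bk.
  by rewrite rmorph0 mulr0 addr0 mxE.
have dN (t : R) u v : (forall k,
    is_derive t 1 (a k) (u * a k t - v * b k t)
    /\ is_derive t 1 (b k) (u * b k t + v * a k t)) ->
    is_derive t 1 N (2 * u * N t).
  move=> dk; have dak k := (dk k).1; have dbk k := (dk k).2.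
  have dterm k := is_deriveD (is_deriveM (dak k) (dak k)) (is_deriveM (dbk k) (dbk k)).
  apply: is_derive_eq (is_derive_sum dterm) _.
  rewrite NE mulr_sumr; apply: eq_bigr => k _.
  by rewrite -![_ *: _]/(_ * _); ring.
have const q : (forall (t : R) u v, (forall k,
    is_derive t 1 (a k) (u * a k t - v * b k t)
    /\ is_derive t 1 (b k) (u * b k t + v * a k t)) ->
    is_derive t 1 q (2 * u * q t)) -> q 1 * N 0 = q 0 * N 1.
  move=> dq; apply: ratio_constant => t t01; split; first exact: N_neq0.
  have [u [v dk]] := dab t t01.
  by exists (2 * u); split; [exact: dq dk | exact: dN dk].
have in0 : (0 : R) \in `[0, 1]%R by rewrite in_itv /= lexx ler01.
have in1 : (1 : R) \in `[0, 1]%R by rewrite in_itv /= lexx ler01.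
have F1 k : F k (toC 1 *: p) = f p k 0 by rewrite rmorph1 scale1r.
have F0 k : F k (toC 0 *: p) = f 0 k 0 by rewrite rmorph0 scale0r.
have [_ fp0 _] := f_ball p rp.
apply: vline_eqP => //.
have [j fpj] : exists j, f p j 0 != 0.
  apply: contrapT => no_j; case/eqP: fp0; apply/colP => j; rewrite mxE.
  by apply/eqP/negPn/negP => fpj; apply: no_j; exists j.
pose cj (t : R) := toC (a j t) - 'i * toC (b j t).
have ii : 'i * 'i = -1 :> C by rewrite -expr2 sqrCi.
have FF k t : F k (toC t *: p) * cj t
    = toC (a k t * a j t + b k t * b j t) + 'i * toC (b k t * a j t - a k t * b j t).
  rewrite {1}(cx_decomp cx (F k _)) -/(a k t) -/(b k t) rmorphB rmorphD !rmorphM /= /cj.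
  transitivity (toC (a k t) * toC (a j t) - ('i * 'i) * (toC (b k t) * toC (b j t))
    + 'i * (toC (b k t) * toC (a j t) - toC (a k t) * toC (b j t))); first ring.
  by rewrite ii; ring.
(* N and the real and imaginary parts of f_k f_j^* all satisfy q' = 2 u q. *)
have key k : f p k 0 * cj 1 * toC (N 0) = f 0 k 0 * cj 0 * toC (N 1).
  rewrite -F1 -F0 !FF !mulrDl -!mulrA -!rmorphM /=.
  congr (toC _ + _ * toC _).
    have := @const (a k * a j + b k * b j); apply=> t u v dk.
    have [dak dbk] := dk k; have [daj dbj] := dk j.
    apply: is_derive_eq (is_deriveD (is_deriveM dak daj) (is_deriveM dbk dbj)) _.
    have -> : (a k * a j + b k * b j) t = a k t * a j t + b k t * b j t by [].
    by rewrite -![_ *: _]/(_ * _); ring.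
  have := @const (b k * a j - a k * b j); apply=> t u v dk.
  have [dak dbk] := dk k; have [daj dbj] := dk j.
  apply: is_derive_eq (is_deriveB (is_deriveM dbk daj) (is_deriveM dak dbj)) _.
  have -> : (b k * a j - a k * b j) t = b k t * a j t - a k t * b j t by [].
  by rewrite -![_ *: _]/(_ * _); ring.
have N0 : toC (N 0) != 0 by rewrite fmorph_eq0 N_neq0.
have cj1 : cj 1 != 0.
  apply: contraNneq fpj => cj10; rewrite -F1 (cx_decomp cx (F j _)) -/(a j 1) -/(b j 1).
  have [aj bj] : a j 1 = 0 /\ b j 1 = 0.
    have := @cx_eq (a j 1) (- b j 1) (cj 1); rewrite /cj rmorphN mulrN => /(_ erefl).
    rewrite -/(cj 1) cj10 -(rmorph0 toC) re_toC im_toC => -[<- /eqP].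
    by rewrite eq_sym oppr_eq0 => /eqP ->.
  by rewrite aj bj rmorph0 mulr0 addr0.
apply/vlineP; exists (cj 0 * toC (N 1) / (cj 1 * toC (N 0))).
apply/colP => k; rewrite mxE mulrAC -[_ * _ * f 0 k 0]mulrC mulrA -key.
by field; rewrite N0 cj1.
Qed.
End ProjectivelyConstant.

Lemma complex_complexification (R : realType) :
  @complexification R R[i] (real_complex R) (@complex.Re R) (@complex.Im R).
Proof.
split.
- by move=> z; rewrite [LHS]complexE.
- by move=> a b; rewrite /= !(mul0r, mul1r, mulr0, subr0, addr0).
- by move=> a b; rewrite /= !(mul0r, mul1r, mulr0, subr0, addr0, add0r).
- exact: normc_ge_Re.
- case=> a b; rewrite normc_def /= lecR -sqrtr_sqr ler_wsqrtr //.
  by rewrite lerDr sqr_ge0.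
- by move=> a; rewrite normc_def /= expr0n addr0 sqrtr_sqr.
- by move=> a b; rewrite ltcR.
move=> [a b]; rewrite ltcE /= => /andP[/eqP b0 a0].
by exists a; rewrite // b0.
Qed.

Unset Implicit Arguments.

Theorem proposition4p3 (R : realType) (m : nat) (hm : (2 <= m)%N)
    (D : spin_space R[i] m) (Xi : spinor R[i] m) (hXi : pure' D Xi) :
  let xi := component Xi in
  let U := complement_of D Xi in
  let N := annihilator D xi in
  let W := twistor_locus D Xi in
  [/\ conformal_killing D xi /\ pure_field D xi,
      null_structure D N U,
      submanifold W /\ arises_from D N U W
    & forall L, leaf N U L ->
        exists A : {vspace vect R[i] m},
          [/\ alpha_plane D A, L = [set x | U x /\ (x <= A)%VS]
            & \dim (A :&: ann' D Xi)%VS = m]].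
Proof.
have proj_const := @proj_constant _ _ _ _ _ (complex_complexification R) m.
move=> xi U N W; split.
- by split; [exact: component_conformal_killing | exact: component_pure_field].
- exact: distribution_null_structure.
- by split; [exact: locus_submanifold | exact: distribution_arises].
exact: leaf_plane.
Qed.
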